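(* For $n\ge3$, let $\{a_{ij}\}_{i,j=1}^n$ be the components of a matrix $A\in\mathbf{R}^{n\times n}$, let $\pi$ be a random permutation uniformly distributed over the symmetric group $\mathcal{S}_n$, and let $$Y=\sum_{i=1}^na_{i,\pi(i)}.$$ Let $$a_{\cdot\cdot}=\frac1{n^2}\sum_{i,j=1}^na_{ij},\qquad a_{i\cdot}=\frac1n\sum_{j=1}^na_{ij},\qquad a_{\cdot j}=\frac1n\sum_{i=1}^na_{ij},$$ $$\mu=na_{\cdot\cdot},\qquad\sigma^2=\frac1{n-1}\sum_{i,j=1}^n(a_{ij}^2-a_{i\cdot}^2-a_{\cdot j}^2+a_{\cdot\cdot}^2),\qquad a_3=\sum_{i,j=1}^n|a_{ij}-a_{i\cdot}-a_{\cdot j}+a_{\cdot\cdot}|^3$$ (so that $\mu=EY$ and $\sigma^2=\mathrm{Var}(Y)$), and assume $\sigma^2>0$. Then, with $F$ the distribution function of $W=(Y-\mu)/\sigma$ and $\Phi$ that of the standard normal, $$\|F-\Phi\|_1\le\frac{a_3}{(n-1)\sigma^3}\left(16+\frac{56}{(n-1)}+\frac{8}{(n-1)^2}\right).$$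
   Context: For distribution functions $F,G$ on $\mathbf{R}$, $\|F-G\|_1=\int_{-\infty}^\infty|F(t)-G(t)|\,dt$. *)

(* Defs.v *)
From HB Require Import structures.
From mathcomp Require Import all_boot all_order all_fingroup all_algebra.
From mathcomp Require Import all_classical all_reals all_analysis.

Set Implicit Arguments.
Unset Strict Implicit.
Unset Printing Implicit Defensive.

Import Order.TTheory GRing.Theory Num.Theory.
Import numFieldNormedType.Exports.

Local Open Scope classical_set_scope.
Local Open Scope ring_scope.

(* The symmetric group carries the discrete sigma-algebra, so that a random
   permutation is a random variable in the sense of the library.  Instances are
   keyed on [perm_type], to which [{perm T}] unfolds. *)
Section perm_measurable.
Variable I : finType.

HB.instance Definition _ := isPointed.Build (perm_type I) (1%g : {perm I}).

HB.instance Definition _ := @isMeasurable.Build default_measure_display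
  (perm_type I) discrete_measurable discrete_measurable0
  discrete_measurableC discrete_measurableU.

Lemma measurable_fun_perm (d : measure_display) (T : measurableType d)
  (f : {perm I} -> T) : measurable_fun [set: {perm I}] f.
Proof. by []. Qed.

End perm_measurable.

Definition uniform_perm (R : realType) (n : nat) (d : measure_display)
    (T : measurableType d) (P : probability T R)
    (pi : {RV P >-> {perm 'I_n}}) : Prop :=
  forall s : {perm 'I_n}, P (pi @^-1` [set s]) = ((n`!%:R : R)^-1)%:E.

Section combinatorial_clt.
Variables (R : realType) (n : nat) (A : 'M[R]_n).

Definition mean_all : R := (\sum_(i < n) \sum_(j < n) A i j) / n%:R ^+ 2.
Definition mean_row (i : 'I_n) : R := (\sum_(j < n) A i j) / n%:R.
Definition mean_col (j : 'I_n) : R := (\sum_(i < n) A i j) / n%:R.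

Definition mu : R := n%:R * mean_all.

Definition sigma2 : R :=
  (\sum_(i < n) \sum_(j < n)
    (A i j ^+ 2 - mean_row i ^+ 2 - mean_col j ^+ 2 + mean_all ^+ 2))
  / (n%:R - 1).

Definition sigma : R := Num.sqrt sigma2.

Definition a3 : R :=
  \sum_(i < n) \sum_(j < n)
    `|A i j - mean_row i - mean_col j + mean_all| ^+ 3.

Definition permY (s : {perm 'I_n}) : R := \sum_(i < n) A i (s i).
Definition permW (s : {perm 'I_n}) : R := (permY s - mu) / sigma.

HB.instance Definition _ :=
  isMeasurableFun.Build _ _ _ _ permY (measurable_fun_perm permY).
HB.instance Definition _ :=
  isMeasurableFun.Build _ _ _ _ permW (measurable_fun_perm permW).

End combinatorial_clt.

Definition Phi (R : realType) (t : R) : \bar R := normal_prob 0 1 `]-oo, t].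

(* Distribution functions are \bar R-valued, as is the library's [cdf]. *)
Definition dist_L1 (R : realType) (F G : R -> \bar R) : \bar R :=
  (\int[lebesgue_measure]_t `|F t - G t|)%E.

(* Main.v *)
(* Stein's method in the zero-bias form.  After centering and scaling, put
   [W s = sum_i b i (s i)] and [D i j p q = b i p + b j q - b i q - b j p].
   Composing [s] with the transposition of [i] and [j] changes [W] by [- D], so
   exchangeability writes [E (W f W)] as an average, with weights proportional to
   [D ^+ 2], of difference quotients of [f] between [y - D] and [y], where
   [y = W s'] and [s'] is uniform given [i |-> p], [j |-> q].  Such an [s'] is
   obtained from a uniform [s] by two transpositions, which costs a few entries of
   [b].  For each threshold [t], the solution [f_t] of Stein's equation for the
   half-line [w <= t] turns [F t - Phi t] into an average of
   [f_t' (W s) - (f_t y - f_t x) / (y - x)], where [x = y - D].  Since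
   [f_t w + (w - t)^+] is convex in [w], this gap is controlled by Bregman
   divergences whose integrals over [t] are explicit, because [f_t w] and [f_t' w]
   integrate over [t] to [1] and [0].  This gives
   [|F - Phi|_1 <= E (|x - W s| + |y - W s|)].  Finally the cross terms in [D ^+ 2]
   vanish by centering, so each entry of [b] met on the way contributes at most one
   unit [a3 / ((n - 1) sigma ^+ 3)]; up to corrections of order [1 / (n - 1)] there
   are 16 of them. *)
Require Import Defs.
From HB Require Import structures.
From mathcomp Require Import all_boot all_order all_fingroup all_algebra.
From mathcomp Require Import all_classical all_reals all_analysis.
From mathcomp Require Import measurable_realfun ring lra.

Set Implicit Arguments.
Unset Strict Implicit.
Unset Printing Implicit Defensive.

Import Order.TTheory GRing.Theory Num.Theory.
Import numFieldNormedType.Exports.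

Local Open Scope classical_set_scope.
Local Open Scope ring_scope.

(** * Counting permutations with prescribed values *)

Section perm_agreement.
Variable T : finType.
Implicit Types (S : seq (T * T)) (s : {perm T}) (x y : T).

Definition agrees S s := all (fun c => s c.1 == c.2) S.

Definition partial_inj S := uniq (unzip1 S) && uniq (unzip2 S).

Lemma agrees_mem S s x y : agrees S s -> (x, y) \in S -> s x = y.
Proof. by move=> /allP h /h /eqP. Qed.

Lemma agrees_notin S s x : agrees S s -> x \notin unzip1 S -> s x \notin unzip2 S.
Proof.
move=> aS; apply: contra => /mapP[[u v] uv /= sxv].
apply/mapP; exists (u, v) => //=.
by apply: (@perm_inj _ s); rewrite sxv (agrees_mem aS uv).
Qed.

Lemma agrees_notin_inv S s y :
  agrees S s -> y \notin unzip2 S -> (s^-1)%g y \notin unzip1 S.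
Proof.
move=> aS; apply: contra => /mapP[[u v] uv /= syu].
apply/mapP; exists (u, v) => //=.
by rewrite -(agrees_mem aS uv) -syu permKV.
Qed.

Lemma agrees_mul_tperm S s r y : r \notin unzip2 S -> y \notin unzip2 S ->
  agrees S (s * tperm r y)%g = agrees S s.
Proof.
move=> rS yS; apply: eq_in_all => -[u v] uvS /=; rewrite permM.
have vS : v \in unzip2 S by apply/mapP; exists (u, v).
have vr : r != v by apply: contraNneq rS => ->.
have vy : y != v by apply: contraNneq yS => ->.
by rewrite -[X in _ == X](tpermD vr vy) (inj_eq perm_inj).
Qed.

(** Right multiplication by [tperm r y] maps the permutations with [s x = r] bijectively onto those
    with [s x = y] and keeps the values prescribed by [S]. So every [r] outside [unzip2 S]
    contributes the same sum. *)
Lemma sum_agrees_tperm (V : nmodType) S x y (g : {perm T} -> V) :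
  partial_inj ((x, y) :: S) ->
  \sum_(s | agrees S s) g (s * tperm (s x) y)%g =
  (\sum_(s | agrees ((x, y) :: S) s) g s) *+ (#|T| - size S).
Proof.
rewrite /partial_inj /= => /andP[/andP[xS uS1] /andP[yS uS2]].
rewrite (partition_big (fun s => s x) (fun r => r \notin unzip2 S)) /=; last first.
  by move=> s aS; exact: agrees_notin aS xS.
rewrite (eq_bigr (fun=> \sum_(s | agrees ((x, y) :: S) s) g s)); last first.
  move=> r rS.
  rewrite (reindex_inj (@mulIg _ (tperm r y))) /=.
  apply: eq_big => [s|s /andP[_ /eqP sxr]].
    rewrite agrees_mul_tperm // andbC permM; congr andb.
    by rewrite -[X in _ == X](tpermR r y) (inj_eq perm_inj).
  congr g; rewrite sxr -mulgA.
  suff -> : (tperm r y * tperm r y)%g = 1%g by rewrite mulg1.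
  by rewrite tperm2.
rewrite sumr_const; congr (_ *+ _).
have -> : #|fun r => r \notin unzip2 S| = #|[predC unzip2 S]| by apply: eq_card.
by rewrite -(cardC (mem (unzip2 S))) (card_uniqP uS2) size_map addKn.
Qed.

(** Taking [g] constant in [sum_agrees_tperm] gives the recursion of the factorial. *)
Lemma card_agrees S : partial_inj S -> #|agrees S| = (#|T| - size S)`!.
Proof.
elim: S => [_|[x y] S IH pS].
  rewrite subn0 -cardsT -card_perm; apply: eq_card => s.
  by rewrite !unfold_in /=; apply/esym/fintype.subsetP => z; rewrite inE.
have pS' : partial_inj S.
  by move: pS; rewrite /partial_inj /= => /andP[/andP[_ ->] /andP[_ ->]].
have lt : (size S < #|T|)%N.
  have /andP[/card_uniqP h _] := pS.
  by have := max_card (mem (unzip1 ((x, y) :: S))); rewrite h size_map.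
have := @sum_agrees_tperm nat S x y (fun=> 1%N) pS.
rewrite /= !sum1_card.
have -> : #|[pred s | agrees S s]| = #|agrees S| by apply: eq_card.
rewrite IH // -mulr_natr.
have -> : (#|T| - size S)%N = (#|T| - (size S).+1).+1 by rewrite subnS prednK // subn_gt0.
rewrite factS mulnC => /eqP; rewrite natn eqn_pmul2r // => /eqP ->.
by apply: eq_card.
Qed.

Lemma card_all_perms : #|{: {perm T}}| = (#|T|)`!.
Proof. by rewrite -[#|T|]subn0 -(card_agrees (S := [::])). Qed.
End perm_agreement.

(** * Upper bounds for sums over permutations with prescribed values *)

Section perm_agreement_sums.
Variables (T : finType) (R : realFieldType).
Implicit Types (S : seq (T * T)) (s : {perm T}) (x y : T).

Lemma agrees_uniq S s : agrees S s -> uniq (unzip1 S) = uniq (unzip2 S).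
Proof.
move=> aS; have -> : unzip2 S = [seq s z | z <- unzip1 S].
  rewrite -map_comp; apply/eq_in_map => -[u v] uv /=.
  by rewrite (agrees_mem aS uv).
by rewrite (map_inj_uniq (@perm_inj _ s)).
Qed.

(** Either nothing agrees with [S], or some permutation does and its injectivity carries uniqueness
    from one coordinate to the other. *)
Lemma card_agrees_le S : uniq (unzip1 S) || uniq (unzip2 S) ->
  (#|agrees S| <= (#|T| - size S)`!)%N.
Proof.
move=> uS; have [->//|/card_gt0P[s aS]] := posnP #|agrees S|.
have e := agrees_uniq aS.
by rewrite card_agrees // /partial_inj -e andbb; move: uS; rewrite -e orbb.
Qed.

Lemma sum_agrees_le (I : finType) (P : pred {perm T}) (h : {perm T} -> I)
    (phi : I -> R) (m : nat) :
  (forall i, 0 <= phi i) -> (forall i, #|[pred s | P s & h s == i]| <= m)%N ->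
  \sum_(s | P s) phi (h s) <= m%:R * \sum_i phi i.
Proof.
move=> phi0 hm; rewrite (partition_big h predT) //= mulr_sumr.
apply: ler_sum => i _.
rewrite (eq_bigr (fun=> phi i)) => [|s /andP[_ /eqP->]//].
rewrite sumr_const -[leLHS]mulr_natl ler_wpM2r // ler_nat.
by apply: leq_trans (hm i); rewrite leq_eqVlt; apply/orP; left; apply/eqP/eq_card.
Qed.

Lemma sum_agrees_image_le S x (phi : T -> R) :
  partial_inj S -> x \notin unzip1 S -> (forall r, 0 <= phi r) ->
  \sum_(s | agrees S s) phi (s x) <=
  (#|T| - (size S).+1)`!%:R * \sum_r phi r.
Proof.
move=> /andP[uS _] xS phi0; apply: sum_agrees_le => // r.
apply: leq_trans (@card_agrees_le ((x, r) :: S) _); last by rewrite /= xS uS.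
by apply: eq_leq; apply: eq_card => s; rewrite !unfold_in /= andbC.
Qed.

Lemma sum_agrees_preimage_le S y (phi : T -> R) :
  partial_inj S -> y \notin unzip2 S -> (forall r, 0 <= phi r) ->
  \sum_(s | agrees S s) phi ((s^-1)%g y) <=
  (#|T| - (size S).+1)`!%:R * \sum_r phi r.
Proof.
move=> /andP[_ uS] yS phi0.
apply: (sum_agrees_le (h := fun s : {perm T} => (s^-1)%g y)) => // r.
apply: leq_trans (@card_agrees_le ((r, y) :: S) _); last by rewrite /= yS uS orbT.
apply: eq_leq; apply: eq_card => s; rewrite !unfold_in /= andbC; congr andb.
by rewrite (canF_eq (permKV s)) eq_sym.
Qed.

(** The condition [s x != y] makes the preimage of [y] differ from [x], so fixing both values
    prescribes two new positions and lowers the factorial by two. *)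
Lemma sum_agrees_preimage_image_le S x y (phi : T * T -> R) :
  partial_inj S -> x \notin unzip1 S -> y \notin unzip2 S ->
  (forall r, 0 <= phi r) ->
  \sum_(s | agrees S s && (s x != y)) phi ((s^-1)%g y, s x) <=
  (#|T| - (size S).+2)`!%:R * \sum_r phi r.
Proof.
move=> /andP[uS _] xS yS phi0.
apply: (sum_agrees_le (h := fun s : {perm T} => ((s^-1)%g y, s x))) => // -[k r].
set C := [pred s | _ & _].
have [->//|/card_gt0P[s0]] := posnP #|C|.
rewrite !inE /= => /andP[/andP[aS sxy] /eqP[sy sx]].
apply: leq_trans (@card_agrees_le ((k, y) :: (x, r) :: S) _).
  apply/subset_leq_card/fintype.subsetP => s; rewrite !unfold_in /=.
  by move=> /andP[/andP[aS' _] /eqP[<- <-]]; rewrite permKV !eqxx; exact: aS'.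
rewrite /= xS uS inE negb_or -sy (agrees_notin_inv aS yS) !andbT.
by rewrite (canF_eq (permKV s0)) [_ == s0 x]eq_sym sxy.
Qed.
End perm_agreement_sums.

(** * Contrasts of a doubly centered array *)

Section cubes.
Variable R : realFieldType.

Lemma young_cube (x y : R) : 0 <= x -> 0 <= y ->
  x ^+ 2 * y <= (2 * x ^+ 3 + y ^+ 3) / 3.
Proof.
move=> x0 y0; rewrite -subr_ge0.
have -> : (2 * x ^+ 3 + y ^+ 3) / 3 - x ^+ 2 * y = (x - y) ^+ 2 * (2 * x + y) / 3.
  by field.
by rewrite divr_ge0 // mulr_ge0 ?sqr_ge0 // addr_ge0 // mulr_ge0.
Qed.

Lemma sum_cst (I : finType) (c : R) : \sum_(i : I) c = #|I|%:R * c.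
Proof. by rewrite sumr_const mulr_natl. Qed.

(** Power mean inequality: by [young_cube] each [u i ^+ 3] lies above the tangent of the cube at the
    mean, and the tangents sum to the left side. *)
Lemma cube_mean_le (I : finType) (u : I -> R) : (forall i, 0 <= u i) ->
  ((\sum_i u i) / #|I|%:R) ^+ 3 * #|I|%:R <= \sum_i u i ^+ 3.
Proof.
move=> u0; have [I0|I_gt0] := posnP #|I|.
  by rewrite I0 mulr0 sumr_ge0 // => i _; rewrite exprn_ge0.
set m := (\sum_i u i) / _.
have m0 : 0 <= m by rewrite divr_ge0 // sumr_ge0.
have -> : m ^+ 3 * #|I|%:R = \sum_i (3 * m ^+ 2 * u i - 2 * m ^+ 3).
  rewrite sumrB -mulr_sumr sum_cst.
  have -> : \sum_i u i = m * #|I|%:R by rewrite divfK // pnatr_eq0 -lt0n.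
  ring.
apply: ler_sum => i _; have := young_cube m0 (u0 i); lra.
Qed.

Lemma sum_shift_sqr (I : finType) (c : R) (x : I -> R) : \sum_i x i = 0 ->
  \sum_i (c + x i) ^+ 2 = #|I|%:R * c ^+ 2 + \sum_i x i ^+ 2.
Proof.
move=> x0; under eq_bigr do rewrite sqrrD.
by rewrite big_split big_split /= sum_cst sumrMnl -mulr_sumr x0 mulr0 mul0rn addr0.
Qed.
End cubes.

Section centered_array.
Variables (R : realFieldType) (T : finType) (b : T -> T -> R).
Hypothesis row0 : forall i, \sum_j b i j = 0.
Hypothesis col0 : forall j, \sum_i b i j = 0.
Local Notation N := (#|T|%:R : R).

Definition contrast i j p q := b i p + b j q - b i q - b j p.

Local Notation D := contrast.
Local Notation S3 := (\sum_i \sum_p `|b i p| ^+ 3).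

(* The cross terms vanish because rows and columns sum to zero. *)
Lemma sum_contrast_sqr i p :
  \sum_j \sum_q D i j p q ^+ 2 =
  \sum_j \sum_q (b i p ^+ 2 + b i q ^+ 2 + b j p ^+ 2 + b j q ^+ 2).
Proof.
(* As a function of [q], the contrast is a constant plus [b j q - b i q], which sums to zero. *)
have E j : \sum_q D i j p q ^+ 2 =
    N * (b i p - b j p) ^+ 2 + \sum_q (b j q - b i q) ^+ 2.
  rewrite -sum_shift_sqr; last by rewrite sumrB !row0 subrr.
  by apply: eq_bigr => q _; rewrite /D; congr (_ ^+ 2); ring.
rewrite (eq_bigr _ (fun j _ => E j)) big_split /= -mulr_sumr.
have -> : \sum_j (b i p - b j p) ^+ 2 = \sum_j (b i p ^+ 2 + b j p ^+ 2).
  rewrite sum_shift_sqr; last by rewrite sumrN col0 oppr0.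
  rewrite big_split /= sum_cst.
  by congr (_ + _); apply: eq_bigr => j _; rewrite sqrrN.
have -> : \sum_j \sum_q (b j q - b i q) ^+ 2 = \sum_j \sum_q (b i q ^+ 2 + b j q ^+ 2).
  rewrite exchange_big [RHS]exchange_big /=; apply: eq_bigr => q _.
  rewrite big_split /= sum_cst -[b i q ^+ 2]sqrrN.
  rewrite -sum_shift_sqr ?col0 //.
  by apply: eq_bigr => j _; congr (_ ^+ 2); ring.
rewrite mulr_sumr -big_split; apply: eq_bigr => j _.
rewrite /= -sum_cst -big_split /=; apply: eq_bigr => q _; ring.
Qed.

Definition contrast_sum (phi : T -> T -> T -> T -> R) :=
  \sum_i \sum_j \sum_p \sum_q D i j p q ^+ 2 * phi i j p q.

Lemma contrast_sum_ip (phi : T -> T -> R) :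
  contrast_sum (fun i j p q => phi i p) =
  \sum_i \sum_p (\sum_j \sum_q D i j p q ^+ 2) * phi i p.
Proof.
apply: eq_bigr => i _; rewrite exchange_big /=; apply: eq_bigr => p _.
by rewrite mulr_suml; apply: eq_bigr => j _; rewrite mulr_suml.
Qed.

Lemma sum4_entries (x : T -> T -> R) :
  \sum_i \sum_p \sum_j \sum_q (x i p + x i q + x j p + x j q) =
  4 * N ^+ 2 * \sum_i \sum_p x i p.
Proof.
set X := \sum_i \sum_p x i p.
have E i p : \sum_j \sum_q (x i p + x i q + x j p + x j q) =
    N ^+ 2 * x i p + N * (\sum_q x i q) + N * (\sum_j x j p) + X.
  under eq_bigr do rewrite !big_split /= !sum_cst.
  by rewrite !big_split /= !sum_cst -mulr_sumr -/X; ring.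
under eq_bigr do under eq_bigr do rewrite E.
under eq_bigr do rewrite !big_split /= !sum_cst -!mulr_sumr.
rewrite !big_split /= !sum_cst -!mulr_sumr.
rewrite [\sum_i \sum_j x j i]exchange_big /= -/X; ring.
Qed.

Lemma contrast_sum1 :
  contrast_sum (fun _ _ _ _ => 1) = 4 * N ^+ 2 * \sum_i \sum_p b i p ^+ 2.
Proof.
rewrite (contrast_sum_ip (fun _ _ => 1)) -sum4_entries.
by under eq_bigr do under eq_bigr do rewrite mulr1 sum_contrast_sqr.
Qed.

(** [sum_contrast_sqr] leaves four products of a squared entry with [phi i p]; Young's inequality
    splits each into cubes. With weights 2/3 and 1/3 these again total one multiple of [S3]. *)
Lemma contrast_sum_ip_le (phi : T -> T -> R) : (forall i p, 0 <= phi i p) ->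
  \sum_i \sum_p phi i p ^+ 3 <= S3 ->
  contrast_sum (fun i j p q => phi i p) <= 4 * N ^+ 2 * S3.
Proof.
move=> phi0 phi3; rewrite contrast_sum_ip.
pose y i p := phi i p ^+ 3; pose x i p := `|b i p| ^+ 3.
have Y j q i p : b j q ^+ 2 * phi i p <= (2 * x j q + y i p) / 3.
  by rewrite -[b j q ^+ 2]real_normK ?num_real //; exact: young_cube.
pose z i p j q := x i p + x i q + x j p + x j q.
have le i p : (\sum_j \sum_q D i j p q ^+ 2) * phi i p <=
    \sum_j \sum_q (2 * z i p j q + 4 * y i p) / 3.
  rewrite sum_contrast_sqr mulr_suml; apply: ler_sum => j _.
  rewrite mulr_suml; apply: ler_sum => q _.
  have := (Y i p i p, Y i q i p, Y j p i p, Y j q i p).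
  case=> [[[h1 h2] h3] h4]; rewrite !mulrDl /z; lra.
apply: le_trans (ler_sum _ (fun i _ => ler_sum _ (fun p _ => le i p))) _.
have -> : \sum_i \sum_p \sum_j \sum_q (2 * z i p j q + 4 * y i p) / 3 =
    (2 * (\sum_i \sum_p \sum_j \sum_q z i p j q) +
     4 * N ^+ 2 * \sum_i \sum_p y i p) / 3.
  rewrite mulrDl mulrAC mulr_sumr [4 * _ * _ / _]mulrAC mulr_sumr -big_split /=.
  apply: eq_bigr => i _; rewrite !mulr_sumr -big_split; apply: eq_bigr => p _ /=.
  have -> : 4 * N ^+ 2 / 3 * y i p = \sum_(j : T) \sum_(q : T) (4 * y i p / 3).
    rewrite !sum_cst; ring.
  rewrite mulr_sumr -big_split; apply: eq_bigr => j _ /=.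
  rewrite mulr_sumr -big_split; apply: eq_bigr => q _ /=; ring.
rewrite sum4_entries -/(y _ _).
have := ler_wpM2l (_ : 0 <= 4 * N ^+ 2) phi3.
rewrite mulr_ge0 ?exprn_ge0 // => /(_ isT); rewrite /x; lra.
Qed.

End centered_array.

(** * The exchangeable pair and the zero-bias coupling *)

Section exchangeable_pair.
Variables (R : realFieldType) (T : finType) (b : T -> T -> R).
Hypothesis row0 : forall i, \sum_j b i j = 0.
Hypothesis col0 : forall j, \sum_i b i j = 0.
Local Notation N := (#|T|%:R : R).
Local Notation D := (contrast b).

Definition perm_sum (s : {perm T}) := \sum_i b i (s i).
Local Notation W := perm_sum.

Lemma contrast_diag_l i p q : D i i p q = 0.
Proof. by rewrite /contrast; ring. Qed.

Lemma contrast_diag_r i j p : D i j p p = 0.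
Proof. by rewrite /contrast; ring. Qed.

Lemma perm_sum_tperm i k (s : {perm T}) : W (tperm i k * s)%g = W s - D i k (s i) (s k).
Proof.
have [<-|ik] := eqVneq i k; first by rewrite contrast_diag_l tperm1 mul1g subr0.
rewrite /W (bigD1 i) // (bigD1 k) 1?eq_sym //= [in RHS](bigD1 i) //.
rewrite [in RHS](bigD1 k) 1?eq_sym //= !permM tpermL tpermR /contrast.
rewrite (eq_bigr (fun x => b x (s x))); first by ring.
by move=> x /andP[xi xk]; rewrite permM tpermD // eq_sym.
Qed.

(** Linear regression property of the exchangeable pair: the mean change of [W] under a random
    transposition is proportional to [W], since centering kills the terms [b i (s j)] and
    [b j (s i)]. *)
Lemma sum_contrast_perm (s : {perm T}) : \sum_i \sum_j D i j (s i) (s j) = 2 * N * W s.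
Proof.
have R0 i : \sum_j b i (s j) = 0.
  by rewrite -[RHS](row0 i) [RHS](reindex_inj (@perm_inj _ s)).
under eq_bigr do rewrite !big_split /= !sumrN R0 col0 sum_cst !oppr0 !addr0.
by rewrite big_split /= -mulr_sumr sum_cst -/(W s); ring.
Qed.

(* Swapping [i] and [j] turns [D] into [- D] and [W] into [W - D]. *)
Lemma sum_contrast_swap (f : R -> R) i j :
  \sum_(s : {perm T}) D i j (s i) (s j) * f (W s) =
  - \sum_(s : {perm T}) D i j (s i) (s j) * f (W s - D i j (s i) (s j)).
Proof.
rewrite (reindex_inj (@mulgI _ (tperm i j))) /= -sumrN; apply: eq_bigr => s _.
by rewrite perm_sum_tperm !permM tpermL tpermR /contrast; ring.
Qed.

(** [sum_contrast_perm] replaces [W s] by contrasts; one of two copies of the resulting sum is then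
    rewritten by [sum_contrast_swap], which creates the increment of [f]. *)
Lemma sum_perm_sum_mul (f : R -> R) :
  4 * N * \sum_(s : {perm T}) W s * f (W s) =
  \sum_i \sum_j \sum_(s : {perm T})
    D i j (s i) (s j) * (f (W s) - f (W s - D i j (s i) (s j))).
Proof.
transitivity (2 * \sum_i \sum_j \sum_(s : {perm T}) D i j (s i) (s j) * f (W s)).
  rewrite (_ : 4 * N * _ = 2 * \sum_(s : {perm T}) 2 * N * W s * f (W s)); last first.
    by under [in RHS]eq_bigr do rewrite -mulrA; rewrite -mulr_sumr; ring.
  congr (_ * _); under eq_bigr do rewrite -sum_contrast_perm mulr_suml.
  rewrite exchange_big; apply: eq_bigr => i _.
  by under eq_bigr do rewrite mulr_suml; rewrite exchange_big.
rewrite mulr_sumr; apply: eq_bigr => i _.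
rewrite mulr_sumr; apply: eq_bigr => j _.
under [RHS]eq_bigr do rewrite mulrBr.
by rewrite sumrB mulr_natl mulr2n {2}sum_contrast_swap.
Qed.

(* Moves [p] to position [i] and then [q] to position [j]; a uniform [s] is sent to
   a uniform permutation among those with [i |-> p], [j |-> q]. *)
Definition couple i j p q (s : {perm T}) : {perm T} :=
  let s1 := (s * tperm (s i) p)%g in (s1 * tperm (s1 j) q)%g.

(** Two uses of [sum_agrees_tperm]: the first with nothing prescribed, giving [N], the second with
    [i |-> p] prescribed, giving [N - 1]. *)
Lemma sum_couple i j p q (g : {perm T} -> R) : i != j -> p != q ->
  \sum_(s : {perm T}) g (couple i j p q s) =
  N * (N - 1) * \sum_(s : {perm T} | (s i == p) && (s j == q)) g s.
Proof.
move=> ij pq.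
rewrite (@sum_agrees_tperm _ _ [::] i p (fun s => g (s * tperm (s j) q)%g)) //.
rewrite (@sum_agrees_tperm _ _ [:: (i, p)] j q g); last first.
  by rewrite /partial_inj /= !inE eq_sym ij eq_sym pq.
rewrite /= subn0 -[LHS]mulr_natl -[_ *+ (_ - 1)]mulr_natl mulrA natrB; last first.
  by apply/card_gt0P; exists i.
by congr (_ * _); apply: eq_bigl => s /=; rewrite andbT andbC.
Qed.

(** Splitting by the values of [s i] and [s j] reduces to [sum_couple]; the vanishing of [h]
    disposes of the degenerate cases [i = j] and [p = q]. *)
Lemma sum_contrast_couple (h : T -> T -> T -> T -> {perm T} -> R) :
  (forall i p q s, h i i p q s = 0) -> (forall i j p s, h i j p p s = 0) ->
  N * (N - 1) * (\sum_i \sum_j \sum_(s : {perm T}) h i j (s i) (s j) s) =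
  \sum_i \sum_j \sum_p \sum_q \sum_(s : {perm T}) h i j p q (couple i j p q s).
Proof.
move=> hi hp; rewrite mulr_sumr; apply: eq_bigr => i _.
rewrite mulr_sumr; apply: eq_bigr => j _.
have [<-|ij] := eqVneq i j.
  rewrite [in RHS]big1 => [|p _]; last by rewrite big1 // => q _; rewrite big1.
  by rewrite big1 ?mulr0.
rewrite (partition_big (fun s : {perm T} => s i) predT) //= mulr_sumr; apply: eq_bigr => p _.
rewrite (partition_big (fun s : {perm T} => s j) predT) //= mulr_sumr; apply: eq_bigr => q _.
have [<-|pq] := eqVneq p q.
  rewrite [in RHS]big1 // big1 ?mulr0 // => s.
  by move=> /andP[/eqP <- /eqP e]; rewrite e hp.
by rewrite sum_couple //; congr (_ * _); apply: eq_bigr => s /andP[/eqP-> /eqP->].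
Qed.

(* The weights [D i j p q ^+ 2 / (4 * N ^+ 2 * (N - 1))] are those of the zero-bias
   coupling; they sum to the variance. *)
Lemma zero_bias_identity (f : R -> R) :
  4 * N ^+ 2 * (N - 1) * \sum_(s : {perm T}) W s * f (W s) =
  \sum_i \sum_j \sum_p \sum_q \sum_(s : {perm T})
    D i j p q * (f (W (couple i j p q s)) - f (W (couple i j p q s) - D i j p q)).
Proof.
rewrite -(sum_contrast_couple
  (h := fun i j p q s => D i j p q * (f (W s) - f (W s - D i j p q)))).
- by rewrite -sum_perm_sum_mul; ring.
- by move=> *; rewrite contrast_diag_l mul0r.
- by move=> *; rewrite contrast_diag_r mul0r.
Qed.

(** The entries other than [b i p] met when [p] is moved to position [i]. The guard puts the first
    term in the scope of [sum_agrees_preimage_image_le]; when [s i = p] nothing moves and the other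
    two terms already cover [- b i p]. *)
Definition jump_bound (s : {perm T}) i p :=
  (if s i != p then `|b ((s^-1)%g p) (s i)| else 0)
  + `|b i (s i)| + `|b ((s^-1)%g p) p|.

Lemma perm_sum_jump (s : {perm T}) i p :
  `|W (s * tperm (s i) p)%g - W s - b i p| <= jump_bound s i p.
Proof.
rewrite /jump_bound; set k := (s^-1)%g p.
have pE : p = s k by rewrite permKV.
(* Exchanging the values [s i] and [p] amounts to exchanging the positions [i] and [k]. *)
have -> : (s * tperm (s i) p = tperm i k * s)%g.
  by rewrite pE -(tpermJ i k s) conjgE mulgA mulgV mul1g.
rewrite perm_sum_tperm -pE /contrast; case: eqP => [e|_] /=.
  have -> : k = i by apply: (@perm_inj _ s); rewrite -pE e.
  rewrite e add0r (_ : _ - _ = - b i p); last by ring.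
  by rewrite normrN lerDl.
rewrite (_ : _ - _ = b k (s i) - b i (s i) - b k p); last by ring.
by rewrite (le_trans (ler_normB _ _)) // lerD2r ler_normB.
Qed.

Lemma perm_sum_couple (s : {perm T}) i j p q :
  `|W (couple i j p q s) - W s - (b i p + b j q)| <=
  jump_bound s i p + jump_bound (s * tperm (s i) p)%g j q.
Proof.
have := lerD (perm_sum_jump s i p) (perm_sum_jump (s * tperm (s i) p)%g j q).
by apply: le_trans; apply: le_trans (ler_normD _ _); rewrite le_eqVlt; apply/orP; left;
  apply/eqP; congr Num.norm; rewrite /couple; ring.
Qed.

(** The two points differ from [W s] by [b i p + b j q] and by [b i q + b j p], up to the same
    remainder, which is therefore counted twice. *)
Lemma couple_dist_le (s : {perm T}) i j p q :
  `|W (couple i j p q s) - W s| + `|W (couple i j p q s) - D i j p q - W s| <=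
  `|b i p| + `|b j q| + `|b i q| + `|b j p|
  + 2 * (jump_bound s i p + jump_bound (s * tperm (s i) p)%g j q).
Proof.
have := perm_sum_couple s i j p q.
set w := W (couple _ _ _ _ _); set z := W s; set B := jump_bound _ _ _ + _ => le.
have l1 : `|w - z| <= `|b i p| + `|b j q| + B.
  rewrite (_ : w - z = b i p + b j q + (w - z - (b i p + b j q))); last by ring.
  by rewrite (le_trans (ler_normD _ _)) // lerD // ler_normD.
have l2 : `|w - D i j p q - z| <= `|b i q| + `|b j p| + B.
  rewrite (_ : w - D i j p q - z = b i q + b j p + (w - z - (b i p + b j q))).
    by rewrite (le_trans (ler_normD _ _)) // lerD // ler_normD.
  by rewrite /contrast; ring.
lra.
Qed.

End exchangeable_pair.

(** * Mean size of the coupling *)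

Section coupling_distance.
Variables (R : realFieldType) (T : finType) (b : T -> T -> R).
Hypothesis row0 : forall i, \sum_j b i j = 0.
Hypothesis col0 : forall j, \sum_i b i j = 0.
Local Notation N := (#|T|%:R : R).
Local Notation D := (contrast b).
Local Notation W := (perm_sum b).
Local Notation S3 := (\sum_i \sum_p `|b i p| ^+ 3).

Lemma contrast_sumD (f g : T -> T -> T -> T -> R) :
  contrast_sum b (fun i j p q => f i j p q + g i j p q) =
  contrast_sum b f + contrast_sum b g.
Proof.
rewrite -big_split; apply: eq_bigr => i _; rewrite -big_split; apply: eq_bigr => j _.
rewrite -big_split; apply: eq_bigr => p _; rewrite -big_split; apply: eq_bigr => q _.
exact: mulrDr.
Qed.

Lemma contrast_sumZ (c : R) (f : T -> T -> T -> T -> R) :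
  contrast_sum b (fun i j p q => c * f i j p q) = c * contrast_sum b f.
Proof.
rewrite mulr_sumr; apply: eq_bigr => i _; rewrite mulr_sumr; apply: eq_bigr => j _.
rewrite mulr_sumr; apply: eq_bigr => p _; rewrite mulr_sumr; apply: eq_bigr => q _.
exact: mulrCA.
Qed.

(** The contrast only changes sign. With [contrast_sum_swap_r] this brings any entry or mean to the
    indices [i] and [p]. *)
Lemma contrast_sum_swap_l (f : T -> T -> T -> T -> R) :
  contrast_sum b (fun i j p q => f j i p q) = contrast_sum b f.
Proof.
rewrite /contrast_sum exchange_big; apply: eq_bigr => i _; apply: eq_bigr => j _.
apply: eq_bigr => p _; apply: eq_bigr => q _.
by rewrite -sqrrN /contrast; congr (_ ^+ 2 * _); ring.
Qed.

Lemma contrast_sum_swap_r (f : T -> T -> T -> T -> R) :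
  contrast_sum b (fun i j p q => f i j q p) = contrast_sum b f.
Proof.
apply: eq_bigr => i _; apply: eq_bigr => j _.
rewrite exchange_big; apply: eq_bigr => p _; apply: eq_bigr => q _.
by rewrite -sqrrN /contrast; congr (_ ^+ 2 * _); ring.
Qed.

Definition row_mean i := (\sum_r `|b i r|) / N.
Definition col_mean p := (\sum_k `|b k p|) / N.
Definition all_mean := (\sum_i \sum_p `|b i p|) / N ^+ 2.

(** Jensen's inequality in each row. It makes [row_mean] an admissible [phi] in
    [contrast_sum_ip_le], as the next two lemmas do for [col_mean] and [all_mean]. *)
Lemma row_mean_cube : \sum_i \sum_(p : T) row_mean i ^+ 3 <= S3.
Proof.
by apply: ler_sum => i _; rewrite sum_cst mulrC; exact: cube_mean_le.
Qed.

Lemma col_mean_cube : \sum_(i : T) \sum_p col_mean p ^+ 3 <= S3.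
Proof.
rewrite exchange_big [leRHS]exchange_big.
by apply: ler_sum => i _; rewrite sum_cst mulrC; exact: cube_mean_le.
Qed.

Lemma all_mean_cube : \sum_(i : T) \sum_(p : T) all_mean ^+ 3 <= S3.
Proof.
have := @cube_mean_le R (T * T)%type (fun x => `|b x.1 x.2|) (fun=> normr_ge0 _).
rewrite -(pair_bigA _ (fun i p => `|b i p|)) -(pair_bigA _ (fun i p => `|b i p| ^+ 3)) /=.
by apply: le_trans; rewrite !sum_cst card_prod natrM /all_mean -expr2 mulrA mulrC.
Qed.

(** The guarded entry has two free indices and the others one. The bounds sum over all of [T],
    including values already taken; this overcount produces the ratios in [dist_bound]. *)
Lemma sum_jump_bound (S : seq (T * T)) i p :
  partial_inj S -> i \notin unzip1 S -> p \notin unzip2 S ->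
  \sum_(s | agrees S s) jump_bound b s i p <=
  (#|T| - (size S).+2)`!%:R * (N ^+ 2 * all_mean) +
  (#|T| - (size S).+1)`!%:R * (N * (row_mean i + col_mean p)).
Proof.
move=> pS iS pS2.
have N0 : N != 0 by rewrite pnatr_eq0 -lt0n; apply/card_gt0P; exists i.
have mean (x : R) (k : nat) : N ^+ k * (x / N ^+ k) = x.
  by rewrite mulrC divfK ?expf_neq0.
rewrite mulrDr [X in _ + _ * (X + _)](mean _ 1) [X in _ + _ * (_ + X)](mean _ 1) mean.
rewrite !big_split /= mulrDr addrA !lerD //.
- rewrite -big_mkcondr /= pair_bigA /=.
  exact: (sum_agrees_preimage_image_le (phi := fun x => `|b x.1 x.2|)).
- exact: (sum_agrees_image_le (phi := fun x => `|b i x|)).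
- exact: (sum_agrees_preimage_le (phi := fun x => `|b x p|)).
Qed.

Hypothesis T3 : (3 <= #|T|)%N.
Local Notation m := (N - 1).

Lemma card_ge3 : 3 <= N. Proof. by rewrite (ler_nat R 3). Qed.

(** The four entries of the contrast, then the means paid for the first move, then those for the
    second, with larger factors because one value is already prescribed. *)
Definition dist_bound i j p q :=
  `|b i p| + `|b j q| + `|b i q| + `|b j p| +
  2 * (N / m * all_mean + row_mean i + col_mean p +
       (N ^+ 2 / (m * (N - 2)) * all_mean + N / m * row_mean j + N / m * col_mean q)).

Lemma sum_couple_dist i j p q : i != j -> p != q ->
  \sum_(s : {perm T}) (`|W (couple i j p q s) - W s| +
                       `|W (couple i j p q s) - D i j p q - W s|) <=
  (#|T|)`!%:R * dist_bound i j p q.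
Proof.
move=> ij pq.
apply: le_trans (ler_sum _ (fun s _ => couple_dist_le b s i j p q)) _.
rewrite big_split /= sum_cst card_all_perms -mulr_sumr big_split /=.
rewrite /dist_bound; set four := `|b i p| + _ + _ + _.
have N3 := card_ge3.
have p1 : partial_inj [:: (i, p)] by [].
have h1 := @sum_jump_bound [::] i p isT isT isT.
have h2 : \sum_(s : {perm T}) jump_bound b (s * tperm (s i) p)%g j q <=
   N * ((#|T| - 3)`!%:R * (N ^+ 2 * all_mean) +
        (#|T| - 2)`!%:R * (N * (row_mean j + col_mean q))).
  rewrite (@sum_agrees_tperm _ _ [::] i p (fun s => jump_bound b s j q)) //.
  rewrite subn0 -[leLHS]mulr_natl ler_wpM2l //.
  by apply: sum_jump_bound; rewrite ?inE // eq_sym.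
have [k kE] : exists k, #|T| = k.+3 by exists (#|T| - 3)%N; rewrite -addn3 subnK.
have e2 : (#|T| - 2)`!%:R = (N - 2) * (#|T| - 3)`!%:R :> R.
  rewrite kE !subSS !subn0 factS natrM; congr (_ * _).
  by rewrite -(natrB _ (isT : (2 <= k.+3)%N)).
have e1 : (#|T| - 1)`!%:R = m * (N - 2) * (#|T| - 3)`!%:R :> R.
  rewrite -mulrA -e2 kE !subSS !subn0 factS natrM; congr (_ * _).
  by rewrite -(natrB _ (isT : (1 <= k.+3)%N)).
have e0 : (#|T|)`!%:R = N * m * (N - 2) * (#|T| - 3)`!%:R :> R.
  by rewrite -!mulrA (mulrA m) -e1 kE !subSS !subn0 factS natrM.
rewrite [leRHS]mulrDr lerD2l mulrCA ler_wpM2l //.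
apply: le_trans (lerD h1 h2) _.
rewrite e2 e1 e0; set F := (#|T| - 3)`!%:R.
rewrite le_eqVlt; apply/orP; left; apply/eqP; field.
by apply/andP; split; apply/eqP; lra.
Qed.

(** Each entry or mean costs at most one unit [4 * N ^+ 2 * S3], so it remains to count them with
    their factors. *)
Lemma contrast_sum_dist :
  contrast_sum b dist_bound <=
  4 * N ^+ 2 * S3 * (16 + 56 / m + 8 / m ^+ 2).
Proof.
have N3 := card_ge3.
set K := 4 * N ^+ 2 * S3.
have K0 : 0 <= K.
  rewrite !mulr_ge0 ?exprn_ge0 //.
  by apply: sumr_ge0 => i _; apply: sumr_ge0 => p _; rewrite exprn_ge0.
have mean0 (I : finType) (u : I -> R) (c : R) : (forall i, 0 <= u i) -> 0 <= c ->
    0 <= (\sum_i u i) / c.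
  by move=> u0 c0; rewrite divr_ge0 // sumr_ge0.
have kb : contrast_sum b (fun i j p q => `|b i p|) <= K.
  exact: contrast_sum_ip_le.
have ka : contrast_sum b (fun i j p q => all_mean) <= K.
  apply: (contrast_sum_ip_le row0 col0 (phi := fun _ _ => _) _ all_mean_cube) => _ _.
  by apply: mean0 => [i|]; rewrite ?sumr_ge0 ?exprn_ge0.
have kr : contrast_sum b (fun i j p q => row_mean i) <= K.
  apply: (contrast_sum_ip_le row0 col0 (phi := fun i _ => _) _ row_mean_cube) => i _.
  exact: mean0.
have kc : contrast_sum b (fun i j p q => col_mean p) <= K.
  apply: (contrast_sum_ip_le row0 col0 (phi := fun _ p => _) _ col_mean_cube) => _ p.
  exact: mean0.
rewrite /dist_bound !contrast_sumD contrast_sumZ !contrast_sumD.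
rewrite !(contrast_sumZ (N / m)) (contrast_sumZ (N ^+ 2 / _)).
rewrite (contrast_sum_swap_l (fun i j p q => row_mean i)).
rewrite (contrast_sum_swap_r (fun i j p q => col_mean p)).
rewrite (contrast_sum_swap_l (fun i j p q => `|b i p|)).
rewrite (contrast_sum_swap_r (fun i j p q => `|b i p|)).
rewrite (contrast_sum_swap_l (fun i j p q => `|b i q|)).
rewrite (contrast_sum_swap_r (fun i j p q => `|b i p|)).
have u0 : 0 <= N / m by rewrite divr_ge0 //; lra.
have v0 : 0 <= N ^+ 2 / (m * (N - 2)).
  by rewrite divr_ge0 ?exprn_ge0 // mulr_ge0; lra.
have ku := ler_wpM2l u0 ka; have ku' := ler_wpM2l u0 kr.
have ku2 := ler_wpM2l u0 kc; have kv := ler_wpM2l v0 ka.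
(* The leading terms agree, 8 + 6 + 2 = 16; the numerator of the difference has positive
   coefficients in [N - 3]. *)
have num : 8 + 6 * (N / m) + 2 * (N ^+ 2 / (m * (N - 2))) <= 16 + 56 / m + 8 / m ^+ 2.
  rewrite -subr_ge0.
  have -> : 16 + 56 / m + 8 / m ^+ 2 - (8 + 6 * (N / m) + 2 * (N ^+ 2 / (m * (N - 2))))
    = (44 * (N - 3) ^+ 2 + 132 * (N - 3) + 80) / (m ^+ 2 * (N - 2)).
    by field; apply/andP; split; apply/eqP; lra.
  rewrite divr_ge0 // ?mulr_ge0 ?exprn_ge0 //; try lra.
  by rewrite !addr_ge0 // mulr_ge0 ?sqr_ge0 //; lra.
have := ler_wpM2l K0 num.
move: ku ku' ku2 kv; set u := N / m; set v := N ^+ 2 / _; set w := 16 + _ + _.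
clearbody u v w K.
move: kb ka kr kc.
generalize (contrast_sum b (fun i _ p _ => `|b i p|)) as cb.
generalize (contrast_sum b (fun _ _ _ _ => all_mean)) as ca.
generalize (contrast_sum b (fun i _ _ _ => row_mean i)) as cr.
generalize (contrast_sum b (fun _ _ p _ => col_mean p)) as cc.
by move=> *; lra.
Qed.

End coupling_distance.

(** * The standard normal distribution function *)

Section derivative_rules.
Variable R : realType.
Implicit Types (f g : R -> R) (x a b : R).

Lemma is_derive_add f g x a b : is_derive x 1 f a -> is_derive x 1 g b ->
  is_derive x 1 (fun y => f y + g y) (a + b).
Proof. exact: is_deriveD. Qed.

Lemma is_derive_mul f g x a b : is_derive x 1 f a -> is_derive x 1 g b ->
  is_derive x 1 (fun y => f y * g y) (f x * b + g x * a).
Proof. exact: is_deriveM. Qed.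

Lemma is_derive_compN f x a : is_derive (- x) 1 f a ->
  is_derive x 1 (fun y => f (- y)) (- a).
Proof.
move=> df; have dN : is_derive x (1:R) -%R (-1) by exact: is_deriveN.
by have := @is_derive1_comp R f -%R x a (-1) df dN; rewrite mulrN1.
Qed.

Lemma is_derive_inv f x a : f x != 0 -> is_derive x 1 f a ->
  is_derive x 1 (fun y => (f y)^-1) (- (a / f x ^+ 2)).
Proof.
move=> fx df. have h := is_deriveV fx df; apply: is_derive_eq h _.
by rewrite /GRing.scale /= mulNr mulrC.
Qed.

End derivative_rules.

Section normal_tail.
Variable R : realType.
Local Notation mu := (@lebesgue_measure R).
Local Notation phi := (@normal_pdf R 0 1).

Definition ncdf (t : R) : R := fine (Phi t).

Lemma PhiE t : Phi t = (ncdf t)%:E.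
Proof.
rewrite /ncdf fineK // /Phi.
by rewrite fin_num_measure.
Qed.

Lemma ncdf_ge0 t : 0 <= ncdf t.
Proof. by rewrite -lee_fin -PhiE /Phi measure_ge0. Qed.

Lemma npdfE x : phi x = normal_peak 1 * expR (- (x ^+ 2 / 2)).
Proof.
by rewrite normal_pdfE ?oner_neq0 // /normal_fun subr0 expr1n mulNr.
Qed.

Lemma npdf_gt0 x : 0 < phi x.
Proof. by rewrite npdfE mulr_gt0 ?expR_gt0 ?normal_peak_gt0 ?oner_neq0. Qed.

Lemma npdfN x : phi (- x) = phi x.
Proof. by rewrite !npdfE sqrrN. Qed.

Lemma is_derive_npdf x : is_derive x (1:R) phi (- (x * phi x)).
Proof.
have -> : phi = fun x => normal_peak 1 * expR (- (x ^+ 2 / 2)).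
  by apply/funext => y; exact: npdfE.
have dx : is_derive x (1:R) id 1 by exact: is_derive_id.
have dx2 : is_derive x (1:R) (fun y : R => - 2^-1 * (y * y)) (- x).
  have h := is_derive_mul (is_derive_cst (- 2^-1 : R) x 1) (is_derive_mul dx dx).
  by apply: is_derive_eq h _; rewrite /=; field.
have -> : (fun x => normal_peak 1 * expR (- (x ^+ 2 / 2))) =
    fun x => normal_peak 1 * (expR \o (fun y : R => - 2^-1 * (y * y))) x.
  by apply/funext => y /=; congr (_ * expR _); field.
have h := is_derive_mul (is_derive_cst (normal_peak 1 : R) x 1)
    (is_derive1_comp (is_derive_expR _) dx2).
apply: is_derive_eq h _.
rewrite /= (_ : - 2^-1 * (x * x) = - (x ^+ 2 / 2)); last by field.
by ring.
Qed.

Lemma npdf_continuous : continuous phi.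
Proof. by apply: continuous_normal_pdf; exact: oner_neq0. Qed.

Lemma is_derive_ncdf x : is_derive x (1:R) ncdf (phi x).
Proof.
have [//|||//|d e] := @continuous_FTC1 R phi -oo%O x (x + 1).
- by rewrite ltrDl.
- by apply: integrableS (integrable_normal_pdf 0 1).
- by rewrite ltNye_eq.
- exact: npdf_continuous.
by apply: DeriveDef; [exact: d|rewrite -derive1E; exact: e].
Qed.

(** The identity as a random variable under the normal law: [ncdf] is its distribution function and
    inherits the limits at both infinities. *)
Let idTR : measurableTypeR R -> R := idfun.

#[local] HB.instance Definition _ :=
  @isMeasurableFun.Build _ _ _ _ idTR (@measurable_id _ _ setT).

Let ncdf_cdf : (fun t => (ncdf t)%:E) = cdf (idTR : {RV normal_prob (0:R) 1 >-> R}).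
Proof. by apply/funext => t; rewrite -PhiE. Qed.

Lemma ncdf_cvgNy : ncdf x @[x --> -oo] --> (0:R).
Proof.
have := cvg_cdfNy0 (idTR : {RV normal_prob (0:R) 1 >-> R}).
by rewrite -ncdf_cdf => /fine_cvgP[].
Qed.

Lemma ncdf_cvgy : ncdf x @[x --> +oo] --> (1:R).
Proof.
have := cvg_cdfy1 (idTR : {RV normal_prob (0:R) 1 >-> R}).
by rewrite -ncdf_cdf => /fine_cvgP[].
Qed.

(** The sum [ncdf y + ncdf (- y)] has zero derivative, since the density is even, and tends to 1 at
    [-oo]. *)
Lemma ncdfN x : ncdf (- x) = 1 - ncdf x.
Proof.
pose h y := ncdf y + ncdf (- y).
have dh y : is_derive y (1:R) h 0.
  have H := is_derive_add (is_derive_ncdf y) (is_derive_compN (is_derive_ncdf (- y))).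
  by apply: is_derive_eq H _; rewrite npdfN subrr.
have h1 : h y @[y --> -oo] --> (0 + 1 : R).
  apply: cvgD ncdf_cvgNy _.
  by apply/cvgNy_compNP; apply: cvg_trans ncdf_cvgy; apply: near_eq_cvg; near=> y;
    rewrite /= opprK.
have h2 : h y @[y --> -oo] --> h x.
  rewrite (_ : h = cst (h x)); first exact: cvg_cst.
  by apply/funext => y; exact: is_derive_0_is_cst.
have := cvg_unique _ h1 h2 => /(_ (@Rhausdorff R) _); rewrite /h => e; lra.
Unshelve. all: by end_near. Qed.

Lemma npdf_cvgNy : phi x @[x --> -oo] --> (0:R).
Proof.
apply/cvgr0Pnorm_lt => e e0; near=> x.
have p0 : 0 < normal_peak (1:R) by rewrite normal_peak_gt0 ?oner_neq0.
rewrite gtr0_norm ?npdf_gt0 // npdfE expRN ltr_pdivrMr ?expR_gt0 //.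
(* The two thresholds give [u < - x / 2 < x ^+ 2 / 2], and [expR] exceeds its argument. *)
have x1 : x < -1 by near: x; apply: nbhs_ninfty_lt; rewrite num_real.
have : x < - (2 * (normal_peak 1 / e)) by near: x; apply: nbhs_ninfty_lt; rewrite num_real.
have : normal_peak 1 = normal_peak 1 / e * e by rewrite divfK ?gt_eqF.
set u := normal_peak 1 / e => -> xu.
rewrite mulrC ltr_pM2l //; apply: lt_le_trans (expR_ge1Dx _); nra.
Unshelve. all: by end_near. Qed.

Lemma ge0_cvgNy0 (f df : R -> R) (c : R) :
  (forall x : R, x <= c -> is_derive x 1 f (df x)) ->
  (forall x : R, x <= c -> 0 <= df x) -> f x @[x --> -oo] --> 0 -> 0 <= f c.
Proof.
move=> dfE df0 /cvgr_to_le; apply; near=> x.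
have xc : x <= c by near: x; apply: nbhs_ninfty_le; rewrite num_real.
have [||y] := @MVT_segment R f df x c xc.
- by move=> y; rewrite in_itv /= => /andP[_ /ltW]; exact: dfE.
- apply: derivable_within_continuous => y; rewrite in_itv /= => /andP[_ yc].
  by have [] := dfE y yc.
- rewrite in_itv /= => /andP[_ yc] /eqP; rewrite subr_eq => /eqP ->.
  by rewrite lerDr mulr_ge0 ?df0 // subr_ge0.
Unshelve. all: by end_near. Qed.

Lemma cvg_bound_npdf_Ny (f : R -> R) :
  (forall x, x <= -1 -> `|f x| <= phi x) -> f x @[x --> -oo] --> 0.
Proof.
move=> fle; apply: norm_cvg0; apply: (@squeeze_cvgr _ _ _ _ (cst 0) phi).
- by apply: filterS (nbhs_ninfty_le (num_real (-1))) => x x1; rewrite normr_ge0 /= fle.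
- exact: cvg_cst.
- exact: npdf_cvgNy.
Qed.

(** The function [- phi y / y - ncdf y] vanishes at [-oo] and has derivative [phi y / y ^+ 2]. *)
Lemma ncdf_le_npdf x : x < 0 -> - x * ncdf x <= phi x.
Proof.
move=> x0; pose f y := - (y^-1 * phi y) - ncdf y.
suff : 0 <= f x.
  rewrite /f subr_ge0 -mulNr -invrN [_ * phi x]mulrC ler_pdivlMr ?oppr_gt0 //.
  by rewrite mulrC.
apply: (@ge0_cvgNy0 _ (fun y => phi y / y ^+ 2)).
- move=> y yx; have y0 : y != 0 by rewrite lt_eqF // (le_lt_trans yx).
  have H := is_derive_add
    (is_deriveN (is_derive_mul (is_derive_inv y0 (is_derive_id y 1)) (is_derive_npdf y)))
    (is_deriveN (is_derive_ncdf y)).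
  by apply: is_derive_eq H _; rewrite /=; field.
- by move=> y _; rewrite divr_ge0 ?sqr_ge0 // ltW // npdf_gt0.
- rewrite -[0]subr0; apply: cvgB ncdf_cvgNy.
  apply: cvg_bound_npdf_Ny => y y1; rewrite normrN normrM (gtr0_norm (npdf_gt0 _)).
  rewrite ler_piMl ?(ltW (npdf_gt0 _)) // normfV invf_le1 ?normr_gt0; last by apply/eqP; lra.
  by rewrite ler0_norm; lra.
Qed.

Let mills_derivative (p y : R) : 1 + y ^+ 2 != 0 ->
  p + ((1 + y ^+ 2)^-1 * (y * - (y * p) + p * 1) +
    y * p * - (2 * y / (1 + y ^+ 2) ^+ 2)) = 2 * p / (1 + y ^+ 2) ^+ 2.
Proof. by move=> h; field. Qed.

(* [ncdf x + x * phi x / (1 + x ^+ 2)] vanishes at [-oo] and has the nonnegative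
   derivative [2 * phi x / (1 + x ^+ 2) ^+ 2]. *)
Lemma mills_lower x : 0 <= (1 + x ^+ 2) * ncdf x + x * phi x.
Proof.
pose d y : R := 1 + y ^+ 2.
have d0 y : 0 < d y by rewrite /d ltr_pwDl ?sqr_ge0.
suff : 0 <= ncdf x + (d x)^-1 * (x * phi x).
  move=> h; have := mulr_ge0 (ltW (d0 x)) h.
  by rewrite mulrDr mulrA divff ?gt_eqF // mul1r.
have dx y : is_derive y (1:R) id 1 by exact: is_derive_id.
have dd y : is_derive y (1:R) d (2 * y).
  have H := is_derive_add (is_derive_cst (1 : R) y 1) (is_derive_mul (dx y) (dx y)).
  by apply: is_derive_eq H _; rewrite /=; ring.
apply: (@ge0_cvgNy0 (fun y => ncdf y + (d y)^-1 * (y * phi y))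
  (fun y => 2 * phi y / d y ^+ 2)).
- move=> y _; have d1 : d y != 0 by rewrite gt_eqF.
  have H := is_derive_add (is_derive_ncdf y)
    (is_derive_mul (is_derive_inv d1 (dd y)) (is_derive_mul (dx y) (is_derive_npdf y))).
  apply: is_derive_eq H _; rewrite /=.
  by move: (phi y) d1 => p d1; move: y d1; exact: mills_derivative.
- by move=> y _; rewrite divr_ge0 ?sqr_ge0 // mulr_ge0 // ltW // npdf_gt0.
- have B : (fun y => (d y)^-1 * (y * phi y)) x @[x --> -oo] --> 0.
    apply: cvg_bound_npdf_Ny => y y1.
    rewrite mulrA normrM [`|phi y|]gtr0_norm ?npdf_gt0 //.
    rewrite ler_piMl ?(ltW (npdf_gt0 _)) // normrM normfV [`|d y|]gtr0_norm ?d0 //.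
    rewrite [leLHS]mulrC ler_pdivrMr ?d0 // mul1r ler0_norm; last by lra.
    by have := sqr_ge0 (y + 1); rewrite /d sqrrD; lra.
  by rewrite -[X in _ --> X](addr0 (0 : R)); exact: (cvgD ncdf_cvgNy B).
Qed.

End normal_tail.

(** * Mills ratio and Stein's equation *)

Section mills_ratio.
Variable R : realType.
Local Notation phi := (@normal_pdf R 0 1).
Local Notation ncdf := (@ncdf R).

(** The classical Mills ratio, upper tail over density, evaluated at [- x]. *)
Definition mills (x : R) := ncdf x / phi x.
Definition mills' (x : R) := 1 + x * mills x.

Lemma is_derive_mills (x : R) : is_derive x 1 mills (mills' x).
Proof.
have phi0 : phi x != 0 by rewrite gt_eqF // npdf_gt0.
have H := is_derive_mul (is_derive_ncdf x) (is_derive_inv phi0 (is_derive_npdf x)).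
apply: is_derive_eq H _; rewrite /mills' /mills.
by move: (phi x) (ncdf x) phi0 => p q p0; field.
Qed.

Lemma is_derive_mills' (x : R) : is_derive x 1 mills' (mills x + x * mills' x).
Proof.
have H := is_derive_add (is_derive_cst (1 : R) x 1)
  (is_derive_mul (is_derive_id x (1 : R)) (is_derive_mills x)).
by apply: is_derive_eq H _; rewrite /=; ring.
Qed.

(** Convexity of [mills]: [mills_lower] says that its second derivative is nonnegative. *)
Lemma le_mills' x y : x <= y -> mills' x <= mills' y.
Proof.
move=> xy; have [||c] := @MVT_segment R mills' (fun x => mills x + x * mills' x) x y xy.
- by move=> z _; exact: is_derive_mills'.
- by apply: derivable_within_continuous => z _; have [] := is_derive_mills' z.
move=> _ e; rewrite -subr_ge0 e mulr_ge0 ?subr_ge0 //.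
have -> : mills c + c * mills' c = ((1 + c ^+ 2) * ncdf c + c * phi c) / phi c.
  have := npdf_gt0 c; rewrite /mills' /mills.
  by move: (phi c) (ncdf c) => p q p0; field; rewrite gt_eqF.
by rewrite divr_ge0 ?mills_lower // ltW // npdf_gt0.
Qed.

Lemma mills_chord x y : x <= y ->
  (y - x) * mills' x <= mills y - mills x <= (y - x) * mills' y.
Proof.
move=> xy; have [||c] := @MVT_segment R mills mills' x y xy.
- by move=> z _; exact: is_derive_mills.
- by apply: derivable_within_continuous => z _; have [] := is_derive_mills z.
rewrite in_itv /= => /andP[xc cy] ->.
by rewrite [mills' c * _]mulrC !ler_wpM2l ?subr_ge0 ?le_mills' .
Qed.

(** The two branches of [stein t] below agree at the kink [w = t]. *)
Lemma mills_cross x : ncdf (- x) * mills x = ncdf x * mills (- x).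
Proof. by rewrite /mills npdfN; ring. Qed.

(* Solution in [w] of Stein's equation for the half-line [w <= t]. *)
Definition stein t w :=
  if t < w then ncdf t * mills (- w) else ncdf (- t) * mills w.

(* Derivative of [stein t] in [w], left derivative at the kink [w = t]. *)
Definition stein' t w :=
  if t < w then - ncdf t * mills' (- w) else ncdf (- t) * mills' w.

Lemma stein_eq t w : stein' t w - w * stein t w = ((w <= t)%R : nat)%:R - ncdf t.
Proof.
by rewrite /stein' /stein /mills' leNgt ncdfN; case: ltP => _ /=; ring.
Qed.

(* Adding [(w - t)^+] removes the jump of [stein' t] and leaves a convex function. *)
Definition ramp (t w : R) := if t < w then w - t else 0.
Let g t w := stein t w + ramp t w.
Let g' t w := stein' t w + ((t < w)%R : nat)%:R.

Let g_left t w : w <= t -> (g t w = ncdf (- t) * mills w) *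
  (g' t w = ncdf (- t) * mills' w).
Proof. by move=> wt; rewrite /g /g' /ramp /stein /stein' ltNge wt /= !addr0. Qed.

(** The formulas of [g_left] and [g_right] both hold at [w = t], so value and slope match across the
    kink and one-sided estimates can be glued there. *)
Let g_right t w : t <= w -> (g t w = ncdf t * mills (- w) + (w - t)) *
  (g' t w = 1 - ncdf t * mills' (- w)).
Proof.
rewrite le_eqVlt => /predU1P[<-|tw]; last first.
  by rewrite /g /g' /ramp /stein /stein' tw /=; split; ring.
rewrite !(g_left (lexx _)) subrr addr0 mills_cross; split=> //.
rewrite /mills' mulrDr mulrCA mills_cross ncdfN; ring.
Qed.

Let g_chord_left t x y : x <= y -> y <= t ->
  (y - x) * g' t x <= g t y - g t x <= (y - x) * g' t y.
Proof.
move=> xy yt; have xt := le_trans xy yt.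
rewrite !(g_left yt) !(g_left xt) -mulrBr !(mulrCA (y - x)).
by rewrite !ler_wpM2l ?ncdf_ge0; have /andP[] := mills_chord xy.
Qed.

Let g_chord_right t x y : x <= y -> t <= x ->
  (y - x) * g' t x <= g t y - g t x <= (y - x) * g' t y.
Proof.
move=> xy tx; have ty := le_trans tx xy.
rewrite !(g_right tx) !(g_right ty).
have /mills_chord/andP[h1 h2] : - y <= - x by rewrite lerN2.
have := ler_wpM2l (ncdf_ge0 t) h1; have := ler_wpM2l (ncdf_ge0 t) h2.
by move=> h3 h4; apply/andP; split; lra.
Qed.

Lemma le_stein_slope t x y : x <= y -> g' t x <= g' t y.
Proof.
move=> xy; have L u v : u <= v -> v <= t -> g' t u <= g' t v.
  move=> uv vt; rewrite !(g_left vt) !(g_left (le_trans uv vt)).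
  by rewrite ler_wpM2l ?ncdf_ge0 // le_mills'.
have G u v : u <= v -> t <= u -> g' t u <= g' t v.
  move=> uv tu; rewrite !(g_right tu) !(g_right (le_trans tu uv)).
  by rewrite lerD2l lerN2 ler_wpM2l ?ncdf_ge0 // le_mills' // lerN2.
have [yt|/ltW ty] := leP y t; first exact: L.
have [tx|/ltW xt] := leP t x; first exact: G.
exact: le_trans (L _ _ xt (lexx _)) (G _ _ ty (lexx _)).
Qed.

Lemma stein_chord t x y : x <= y ->
  (y - x) * g' t x <= g t y - g t x <= (y - x) * g' t y.
Proof.
move=> xy; have [yt|/ltW ty] := leP y t; first exact: g_chord_left.
have [tx|/ltW xt] := leP t x; first exact: g_chord_right.
(* Remaining case [x <= t <= y]: add the chords over the two halves and compare the slope at [t]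
   with those at the ends. *)
have /andP[l1 l2] := g_chord_left xt (lexx t).
have /andP[r1 r2] := g_chord_right ty (lexx t).
have m1 : 0 <= y - t by rewrite subr_ge0.
have m2 : 0 <= t - x by rewrite subr_ge0.
have := ler_wpM2l m1 (le_stein_slope t xt); have := ler_wpM2l m2 (le_stein_slope t ty).
by move=> h1 h2; apply/andP; split; lra.
Qed.

End mills_ratio.

(** * Integrals in the threshold *)

Section integrates.
Variable R : realType.
Local Notation mu := (@lebesgue_measure R).
Implicit Types (f g : R -> R) (u v : R).

(** Carrying integrability together with a real value makes linear combinations computable in
    [R]. *)
Definition integrates f v :=
  mu.-integrable [set: R] (EFin \o f) /\ (\int[mu]_t (f t)%:E = v%:E)%E.

Lemma integratesD f g u v : integrates f u -> integrates g v ->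
  integrates (fun t => f t + g t) (u + v).
Proof.
move=> [f1 f2] [g1 g2]; split; first exact: (integrableD measurableT f1 g1).
have := integralD measurableT f1 g1.
by rewrite /= f2 g2 -EFinD => <-; apply: eq_integral => t _; rewrite EFinD.
Qed.

Lemma integratesZ (k : R) f v : integrates f v ->
  integrates (fun t => k * f t) (k * v).
Proof.
move=> [f1 f2]; split; first exact: (integrableZl measurableT k f1).
have := integralZl measurableT f1 k.
by rewrite /= f2 -EFinM => <-; apply: eq_integral => t _; rewrite EFinM.
Qed.

Lemma eq_integrates f g u v : f =1 g -> u = v -> integrates f u -> integrates g v.
Proof. by move=> /funext -> ->. Qed.

Lemma integrates_restrict (D : set R) f v : measurable D ->
  measurable_fun D f -> (forall t, D t -> 0 <= f t) ->
  (\int[mu]_(t in D) (f t)%:E = v%:E)%E -> integrates (f \_ D) v.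
Proof.
move=> mD mf f0 fv.
have iD : mu.-integrable D (EFin \o f).
  apply/integrableP; split; first exact/measurable_EFinP.
  apply: le_lt_trans (ltry v); rewrite -fv le_eqVlt; apply/orP; left; apply/eqP.
  by apply: eq_integral => t /set_mem Dt; rewrite /= ger0_norm ?f0.
split; first by move: iD; rewrite integrable_mkcond //= restrict_EFin.
rewrite -fv [RHS]integral_mkcond; apply: eq_integral => t _.
by rewrite !patchE; case: ifP.
Qed.

End integrates.

(** * Integrals of the normal distribution function over half-lines *)

Section normal_integrals.
Variable R : realType.
Local Notation mu := (@lebesgue_measure R).
Local Notation phi := (@normal_pdf R 0 1).
Local Notation ncdf := (@ncdf R).

Lemma is_derive_continuous (f df : R -> R) :
  (forall x : R, is_derive x 1 f (df x)) -> continuous f.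
Proof.
move=> fd x; apply: differentiable_continuous; apply/derivable1_diffP.
by have [] := fd x.
Qed.

Lemma ncdf_continuous : continuous ncdf.
Proof. exact: is_derive_continuous (@is_derive_ncdf R). Qed.

(** The antiderivative of [ncdf] that vanishes at [-oo]. *)
Definition ncdf_int (x : R) := x * ncdf x + phi x.

Lemma is_derive_ncdf_int (x : R) : is_derive x 1 ncdf_int (ncdf x).
Proof.
have H := is_derive_add (is_derive_mul (is_derive_id x (1 : R)) (is_derive_ncdf x))
  (is_derive_npdf x).
by apply: is_derive_eq H _; rewrite /=; ring.
Qed.

Lemma ncdf_int_cvgNy : ncdf_int x @[x --> -oo] --> (0 : R).
Proof.
rewrite -[X in _ --> X](addr0 (0 : R)).
have h : (fun x => x * ncdf x) x @[x --> -oo] --> (0 : R).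
  apply: cvg_bound_npdf_Ny => x x1; rewrite normrM (ger0_norm (ncdf_ge0 x)).
  by rewrite ler0_norm; [apply: ncdf_le_npdf; lra|lra].
exact: (cvgD h (@npdf_cvgNy R)).
Qed.

Lemma integral_ncdfN a :
  (\int[mu]_(t in `[a, +oo[) (ncdf (- t))%:E = (ncdf_int (- a))%:E)%E.
Proof.
pose F t := - ncdf_int (- t).
have dF t : is_derive t (1:R) F (ncdf (- t)).
  have H := is_derive_compN (is_derive_ncdf_int (- t)).
  by have H' := is_deriveN H; apply: is_derive_eq H' _; rewrite opprK.
rewrite (@ge0_continuous_FTC2y R (fun t => ncdf (- t)) F a 0).
- by rewrite /F sub0e -EFinN opprK.
- by move=> *; exact: ncdf_ge0.
- apply: continuous_subspaceT.
  exact: is_derive_continuous (fun x => is_derive_compN (is_derive_ncdf (- x))).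
- rewrite -[X in _ --> X]oppr0; apply: cvgN.
  by apply/(cvgNy_compNP ncdf_int); exact: ncdf_int_cvgNy.
- by move=> x _; have [] := dF x.
- by apply: cvg_at_right_filter; exact: is_derive_continuous dF a.
- by move=> x _; rewrite derive1E; have [] := dF x.
Qed.

Lemma integral_ncdf a :
  (\int[mu]_(t in `]-oo, a]) (ncdf t)%:E = (ncdf_int a)%:E)%E.
Proof.
rewrite -[a]opprK ge0_integration_by_substitutionNy.
- exact: integral_ncdfN.
- by apply: continuous_subspaceT; exact: ncdf_continuous.
- by move=> *; exact: ncdf_ge0.
Qed.

(** For fixed [w], both [stein t w] and [stein' t w] have this shape in [t], with coefficients
    depending on [w] only. *)
Lemma integrates_split (w al be : R) :
  integrates (fun t => if t < w then al * ncdf t else be * ncdf (- t))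
    (al * ncdf_int w + be * ncdf_int (- w)).
Proof.
have mn : measurable_fun [set: R] ncdf.
  by apply: continuous_measurable_fun; exact: ncdf_continuous.
have mnN : measurable_fun [set: R] (fun t => ncdf (- t)).
  apply: continuous_measurable_fun.
  exact: is_derive_continuous (fun x => is_derive_compN (is_derive_ncdf (- x))).
have h1 : integrates (ncdf \_ `]-oo, w[%classic) (ncdf_int w).
  apply: integrates_restrict => //.
  - exact: measurable_funS mn.
  - by move=> *; exact: ncdf_ge0.
  - rewrite integral_itv_bndo_bndc; first exact: integral_ncdf.
    by apply/measurable_EFinP; exact: measurable_funS mn.
have h2 : integrates ((fun t => ncdf (- t)) \_ `[w, +oo[%classic) (ncdf_int (- w)).
  apply: integrates_restrict => //.
  - exact: measurable_funS mnN.
  - by move=> *; exact: ncdf_ge0.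
  - exact: integral_ncdfN.
apply: eq_integrates (integratesD (integratesZ al h1) (integratesZ be h2)) => // t.
rewrite /= !patchE !mem_setE !in_itv /= andbT leNgt.
by case: (t < w) => /=; rewrite ?mulr0 ?addr0 ?add0r.
Qed.

End normal_integrals.

(** * The ramp and its Bregman divergence *)

Section ramp.
Variable R : realType.
Local Notation mu := (@lebesgue_measure R).

Definition ramp_gap (t y z : R) := ramp t y - ramp t z - (y - z) * ((t < z)%R : nat)%:R.

Lemma integrates_affine (a b c k : R) : a <= b ->
  (forall t, a <= t < b -> 0 <= c + k * t) ->
  integrates (fun t => if a <= t < b then c + k * t else 0)
    ((b - a) * (c + k * (a + b) / 2)).
Proof.
move=> ab f0.
have -> : (fun t => if a <= t < b then c + k * t else 0) =
    (fun t => c + k * t) \_ `[a, b[%classic.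
  by apply/funext => t; rewrite patchE mem_setE in_itv.
pose F t := c * t + k / 2 * (t * t).
have dF t : is_derive t (1:R) F (c + k * t).
  have dt := is_derive_id t (1 : R).
  have H := is_derive_add (is_derive_mul (is_derive_cst c t (1 : R)) dt)
    (is_derive_mul (is_derive_cst (k / 2) t (1 : R)) (is_derive_mul dt dt)).
  by apply: is_derive_eq H _; rewrite /=; field.
have df t : is_derive t (1:R) (fun t => c + k * t) k.
  have H := is_derive_add (is_derive_cst c t (1 : R))
    (is_derive_mul (is_derive_cst k t (1 : R)) (is_derive_id t (1 : R))).
  by apply: is_derive_eq H _; rewrite /=; ring.
have mf : measurable_fun [set: R] (fun t => c + k * t).
  by apply: continuous_measurable_fun; exact: is_derive_continuous df.
apply: integrates_restrict => //.
  exact: measurable_funS mf.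
have [<-|ltab] := eqVneq a b.
  by rewrite set_itvco0 integral_set0 subrr mul0r.
rewrite integral_itv_bndo_bndc; last first.
  by apply/measurable_EFinP; exact: measurable_funS mf.
rewrite (@continuous_FTC2 R _ F).
- by rewrite -EFinB /F; congr EFin; field.
- by rewrite lt_neqAle ltab.
- by apply: continuous_subspaceT; exact: is_derive_continuous df.
- have cF := is_derive_continuous dF; split.
  + by move=> t _; have [] := dF t.
  + exact: cvg_at_right_filter (cF a).
  + exact: cvg_at_left_filter (cF b).
- by move=> t _; rewrite derive1E; have [] := dF t.
Qed.

(** As a function of [t] the gap is [|y - t|] between [y] and [z] and zero outside, so its integral
    is the area of a triangle. *)
Lemma integrates_ramp_gap y z :
  integrates (fun t => ramp_gap t y z) ((y - z) ^+ 2 / 2).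
Proof.
have [zy|/ltW yz] := leP z y.
  have h := @integrates_affine z y y (-1) zy.
  apply: eq_integrates (h _) => [t||t /andP[_ ty]]; last by lra.
    rewrite /ramp_gap /ramp.
    have [zt|tz] := leP z t; first by case: (t < y) => /=; ring.
    by rewrite (lt_le_trans tz zy) /=; ring.
  by field.
have h := @integrates_affine y z (- y) 1 yz.
apply: eq_integrates (h _) => [t||t /andP[yt _]]; last by lra.
  rewrite /ramp_gap /ramp.
  have [yt|ty] := leP y t; first by case: (t < z) => /=; ring.
  by rewrite (lt_le_trans ty yz) /=; ring.
by field.
Qed.

End ramp.

(** * Stein's solution integrated over the threshold *)

Section stein_kernel.
Variable R : realType.
Local Notation mu := (@lebesgue_measure R).
Local Notation ncdf := (@ncdf R).

(** The terms with factor [w] cancel and [ncdf (- w) + ncdf w] remains. *)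
Lemma integrates_stein (w : R) : integrates (fun t => stein t w) 1.
Proof.
apply: eq_integrates (integrates_split w (mills (- w)) (mills w)) => [t|].
  by rewrite /stein mulrC [mills w * _]mulrC.
have := npdf_gt0 w; rewrite /mills /ncdf_int !npdfN ncdfN.
by move: (normal_pdf _ _ _) (ncdf w) => p q p0; field; rewrite gt_eqF.
Qed.

(** Since [mills' x] is [ncdf_int x] divided by the density at [x], the two halves are opposite. *)
Lemma integrates_stein' (w : R) : integrates (fun t => stein' t w) 0.
Proof.
apply: eq_integrates (integrates_split w (- mills' (- w)) (mills' w)) => [t|].
  by rewrite /stein' mulNr mulNr mulrC [mills' w * _]mulrC.
have := npdf_gt0 w; rewrite /mills' /mills /ncdf_int !npdfN ncdfN.
by move: (normal_pdf _ _ _) (ncdf w) => p q p0; field; rewrite gt_eqF.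
Qed.

(* Bregman divergence at [z] of the convex function [w |-> stein t w + 2 * ramp t w]. *)
Definition bregman (t y z : R) :=
  stein t y - stein t z - (y - z) * stein' t z + 2 * ramp_gap t y z.

(** The Stein terms integrate to [1 - 1 - (y - z) * 0], so only the ramp part is left. *)
Lemma integrates_bregman y z : integrates (fun t => bregman t y z) ((y - z) ^+ 2).
Proof.
have h := integratesD (integratesD (integratesD (integrates_stein y)
  (integratesZ (-1) (integrates_stein z))) (integratesZ (- (y - z)) (integrates_stein' z)))
  (integratesZ 2 (integrates_ramp_gap y z)).
by apply: eq_integrates h => [t|]; [rewrite /bregman; ring|field].
Qed.

(** Derivative at [z] against the difference quotient on [x], [y], multiplied by [y - x] so that
    [x = y] is harmless. *)
Definition stein_gap (x y z t : R) :=
  `|(y - x) * stein' t z - (stein t y - stein t x)|.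

Lemma stein_gapC x y z t : stein_gap x y z t = stein_gap y x z t.
Proof. by rewrite /stein_gap -normrN; congr Num.norm; ring. Qed.

Lemma measurable_stein_gap x y z : measurable_fun [set: R] (stein_gap x y z).
Proof.
have [h _] := integratesD (integratesD (integratesZ (y - x) (integrates_stein' z))
  (integratesZ (-1) (integrates_stein y))) (integrates_stein x).
have : measurable_fun [set: R] (fun t => (y - x) * stein' t z - (stein t y - stein t x)).
  have /integrableP[/measurable_EFinP + _] := h.
  by apply: eq_measurable_fun => t _ /=; ring.
exact: measurableT_comp.
Qed.

Lemma ramp_chord (t x y : R) : x <= y ->
  (y - x) * ((t < x)%R : nat)%:R <= ramp t y - ramp t x
    <= (y - x) * ((t < y)%R : nat)%:R.
Proof.
move=> xy; rewrite /ramp; have [tx|xt] := ltP t x.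
  by rewrite (lt_le_trans tx xy) /=; apply/andP; split; lra.
by case: ltP => ty /=; apply/andP; split; lra.
Qed.

(** [G] and [H] are increments of the Bregman divergences at [z] of the convex functions
    [stein t + ramp t] and [ramp t]. The gap is [|H - G|], the increment of [bregman] is [G + H],
    and on either side of [z] the two have the same sign, so [|H - G| <= |G + H|]; if [z] lies
    between [x] and [y], split there. *)
Lemma stein_gap_le x y z t : x <= y ->
  stein_gap x y z t <= if z <= x then bregman t y z - bregman t x z else
    if y <= z then bregman t x z - bregman t y z else bregman t x z + bregman t y z.
Proof.
pose G u v := (stein t v + ramp t v) - (stein t u + ramp t u)
  - (v - u) * (stein' t z + ((t < z)%R : nat)%:R).
pose H u v := ramp t v - ramp t u - (v - u) * ((t < z)%R : nat)%:R.
have Gge u v : z <= u -> u <= v -> 0 <= G u v.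
  move=> zu uv; have /andP[h _] := stein_chord t uv.
  have := ler_wpM2l (_ : 0 <= v - u) (le_stein_slope t zu); rewrite subr_ge0 => /(_ uv).
  by rewrite /G; lra.
have Gle u v : v <= z -> u <= v -> G u v <= 0.
  move=> vz uv; have /andP[_ h] := stein_chord t uv.
  have := ler_wpM2l (_ : 0 <= v - u) (le_stein_slope t vz); rewrite subr_ge0 => /(_ uv).
  by rewrite /G; lra.
have lt_mono u v : u <= v -> ((t < u)%R : nat)%:R <= ((t < v)%R : nat)%:R :> R.
  by move=> uv; rewrite ler_nat; case: ltP => // tu; rewrite (lt_le_trans tu uv).
have Hge u v : z <= u -> u <= v -> 0 <= H u v.
  move=> zu uv; have /andP[h _] := ramp_chord t uv.
  have := ler_wpM2l (_ : 0 <= v - u) (lt_mono _ _ zu); rewrite subr_ge0 => /(_ uv).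
  by rewrite /H; lra.
have Hle u v : v <= z -> u <= v -> H u v <= 0.
  move=> vz uv; have /andP[_ h] := ramp_chord t uv.
  have := ler_wpM2l (_ : 0 <= v - u) (lt_mono _ _ vz); rewrite subr_ge0 => /(_ uv).
  by rewrite /H; lra.
have bE u v : bregman t v z - bregman t u z = G u v + H u v.
  by rewrite /bregman /ramp_gap /G /H; ring.
have bz : bregman t z z = 0 by rewrite /bregman /ramp_gap; ring.
have gE u v : (v - u) * stein' t z - (stein t v - stein t u) = H u v - G u v.
  by rewrite /G /H; ring.
have GD u v w : G u w = G u v + G v w by rewrite /G; ring.
have HD u v w : H u w = H u v + H v w by rewrite /H; ring.
clearbody G H; move=> xy; rewrite /stein_gap gE.
case: ifPn => [zx|]; first by rewrite bE ler_norml; have := Gge _ _ zx xy;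
  have := Hge _ _ zx xy => h1 h2; apply/andP; split; lra.
rewrite -ltNge => /ltW xz; case: ifPn => [yz|].
  have -> : bregman t x z - bregman t y z = - (G x y + H x y) by rewrite -bE; ring.
  rewrite ler_norml; have := Gle _ _ yz xy; have := Hle _ _ yz xy => h1 h2.
  by apply/andP; split; lra.
rewrite -ltNge => /ltW zy.
have -> : bregman t x z = - (G x z + H x z) by rewrite -bE bz; ring.
have -> : bregman t y z = G z y + H z y by rewrite -bE bz; ring.
rewrite (GD x z y) (HD x z y).
have := Gge _ _ (lexx z) zy; have := Hge _ _ (lexx z) zy.
have := Gle _ _ (lexx z) xz; have := Hle _ _ (lexx z) xz => h1 h2 h3 h4.
by rewrite ler_norml; apply/andP; split; lra.
Qed.

(** For [x <= y] and [z] outside the interval, the bound integrates to a difference of squares,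
    which factors as the right side. For [z] inside, [y - x = |x - z| + |y - z|], whose square
    dominates the sum of squares. *)
Lemma integral_stein_gap x y z :
  (\int[mu]_t (stein_gap x y z t)%:E <=
   (`|y - x| * (`|x - z| + `|y - z|))%:E)%E.
Proof.
wlog xy : x y / x <= y.
  move=> H; have [/H //|/ltW/H] := leP x y.
  by rewrite (distrC x y) (addrC `|y - z|); under eq_integral do rewrite stein_gapC.
have [B [v [[iB iBv] leB ltv]]] : exists B v, [/\ integrates B v,
    forall t, stein_gap x y z t <= B t & v <= `|y - x| * (`|x - z| + `|y - z|)].
  have bx := integrates_bregman x z; have byz := integrates_bregman y z.
  rewrite (ger0_norm (_ : 0 <= y - x)) ?subr_ge0 //.
  have := stein_gap_le z _ xy; have [zx|xz] := leP z x.
    move=> le; exists (fun t => bregman t y z + (-1) * bregman t x z).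
    eexists; split; first exact: integratesD byz (integratesZ (-1) bx).
      by move=> t; rewrite mulN1r; exact: le.
    by rewrite !ger0_norm ?subr_ge0 ?(le_trans zx) // -subr_ge0; nra.
  have [yz|zy] := leP y z.
    move=> le; exists (fun t => bregman t x z + (-1) * bregman t y z).
    eexists; split; first exact: integratesD bx (integratesZ (-1) byz).
      by move=> t; rewrite mulN1r; exact: le.
    by rewrite !ler0_norm ?subr_le0 ?(ltW xz) // -subr_ge0; nra.
  move=> le; exists (fun t => bregman t x z + bregman t y z).
  eexists; split; [exact: integratesD bx byz|exact: le|].
  rewrite ler0_norm ?subr_le0 ?(ltW xz) // ger0_norm ?subr_ge0 ?(ltW zy) //.
  by rewrite -subr_ge0; nra.
rewrite -lee_fin -iBv in ltv; apply: le_trans ltv.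
apply: ge0_le_integral => //.
- by move=> t _; rewrite lee_fin normr_ge0.
- by apply/measurable_EFinP; exact: measurable_stein_gap.
- by have /integrableP[] := iB.
- by move=> t _; rewrite lee_fin.
Qed.

End stein_kernel.

(** * The distribution of a permutation sum *)

Lemma integral_le_sum (R : realType) (I : finType) (f : R -> R) (c v : I -> R)
    (g : I -> R -> R) :
  measurable_fun [set: R] f -> (forall i, measurable_fun [set: R] (g i)) ->
  (forall t, 0 <= f t) -> (forall i t, 0 <= g i t) -> (forall i, 0 <= c i) ->
  (forall t, f t <= \sum_i c i * g i t) ->
  (forall i, (\int[lebesgue_measure]_t (g i t)%:E <= (v i)%:E)%E) ->
  (\int[lebesgue_measure]_t (f t)%:E <= (\sum_i c i * v i)%:E)%E.
Proof.
move=> mf mg f0 g0 c0 fg gv.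
have mcg i : measurable_fun [set: R] (fun t => c i * g i t).
  exact: measurable_funM.
apply: (@le_trans _ _ (\int[lebesgue_measure]_t (\sum_i (c i * g i t)%:E))%E).
  apply: ge0_le_integral => //.
  - by move=> t _; rewrite lee_fin.
  - exact/measurable_EFinP.
  - by apply: emeasurable_sum => i; apply/measurable_EFinP; exact: mcg.
  - by move=> t _; rewrite sumEFin lee_fin.
rewrite ge0_integral_sum //=.
- rewrite -sumEFin; apply: lee_sum => i _.
  under eq_integral do rewrite EFinM.
  rewrite ge0_integralZl_EFin //; first by rewrite EFinM; apply: lee_wpmul2l; rewrite ?lee_fin.
  + by move=> t _; rewrite lee_fin.
  + by apply/measurable_EFinP; exact: mg.
- by move=> i; apply/measurable_EFinP; exact: mcg.
- by move=> i t _; rewrite lee_fin mulr_ge0.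
Qed.

Section perm_sum_distance.
Variables (R : realType) (T : finType) (b : T -> T -> R).
Hypothesis row0 : forall i, \sum_j b i j = 0.
Hypothesis col0 : forall j, \sum_i b i j = 0.
Local Notation N := (#|T|%:R : R).
Local Notation D := (contrast b).
Local Notation W := (perm_sum b).
Local Notation mu := (@lebesgue_measure R).

Lemma zero_bias_factor_gt0 : (1 < #|T|)%N -> 0 < 4 * N ^+ 2 * (N - 1).
Proof.
move=> T1; have N1 : 1 < N by rewrite ltr1n.
by rewrite !mulr_gt0 ?exprn_gt0 ?subr_gt0 //; lra.
Qed.

Lemma sum_perm_sum : (1 < #|T|)%N -> \sum_(s : {perm T}) W s = 0.
Proof.
move=> T1; have := zero_bias_identity row0 col0 (fun=> 1).
under eq_bigr do rewrite mulr1.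
rewrite [RHS]big1 => [/eqP|i _]; last first.
  rewrite big1 // => j _; rewrite big1 // => p _; rewrite big1 // => q _.
  by rewrite big1 // => s _; rewrite subrr mulr0.
have K0 : 0 < 4 * N ^+ 2 * (N - 1) by exact: zero_bias_factor_gt0.
by rewrite mulf_eq0 gt_eqF //= => /eqP.
Qed.

(** In [zero_bias_identity] with the identity function each increment is the contrast itself, so the
    right side becomes the total weight [contrast_sum1]. *)
Lemma sum_perm_sum_sqr : (1 < #|T|)%N ->
  (\sum_(s : {perm T}) W s ^+ 2) / (#|T|)`!%:R = (\sum_i \sum_j b i j ^+ 2) / (N - 1).
Proof.
move=> T1; have K0 := zero_bias_factor_gt0 T1.
have e : 4 * N ^+ 2 * (N - 1) * \sum_(s : {perm T}) W s ^+ 2 =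
    (#|T|)`!%:R * (4 * N ^+ 2 * \sum_i \sum_j b i j ^+ 2).
  under eq_bigr do rewrite expr2.
  rewrite (zero_bias_identity row0 col0 id) -(contrast_sum1 row0 col0) -contrast_sumZ.
  do 4![apply: eq_bigr => ? _].
  by under eq_bigr do rewrite subKr; rewrite sum_cst card_all_perms; ring.
have F0 : (#|T|)`!%:R != 0 :> R by rewrite pnatr_eq0 -lt0n fact_gt0.
have N1 : 1 < N by rewrite ltr1n.
have N0 : 4 * N ^+ 2 != 0 by rewrite mulf_neq0 ?expf_neq0 ?pnatr_eq0 // -lt0n ltnW.
have N1' : N - 1 != 0 by rewrite subr_eq0 gt_eqF.
apply/eqP; rewrite eqr_div //; apply/eqP; apply: (mulfI N0).
by move: e; set X := \sum_s _; set Y := \sum_i _ => e; lra.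
Qed.


Definition perm_cdf (t : R) : R :=
  (\sum_(s : {perm T}) ((W s <= t)%R : nat)%:R) / (#|T|)`!%:R.

Let gap i j p q s t :=
  stein_gap (W (couple i j p q s) - D i j p q) (W (couple i j p q s)) (W s) t.

(** Sum [stein_eq] at the points [W s] and treat the term [w * stein t w] by
    [zero_bias_identity]. *)
Lemma discrepancy_le t : (1 < #|T|)%N -> \sum_i \sum_j b i j ^+ 2 = N - 1 ->
  4 * N ^+ 2 * (N - 1) * (#|T|)`!%:R * `|perm_cdf t - ncdf t| <=
  \sum_i \sum_j \sum_p \sum_q \sum_(s : {perm T}) `|D i j p q| * gap i j p q s t.
Proof.
move=> T1 b2; have K0 := zero_bias_factor_gt0 T1.
have F0 : 0 < (#|T|)`!%:R :> R by rewrite ltr0n fact_gt0.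
set K := _ * (N - 1).
have e : K * \sum_(s : {perm T}) (((W s <= t)%R : nat)%:R - ncdf t) =
    \sum_i \sum_j \sum_p \sum_q \sum_(s : {perm T})
      D i j p q * (D i j p q * stein' t (W s) -
        (stein t (W (couple i j p q s)) - stein t (W (couple i j p q s) - D i j p q))).
  (* By [b2] the weights [D ^+ 2] total [K], so [stein'] can be spread over the same indices. *)
  have KE : K * \sum_(s : {perm T}) stein' t (W s) = \sum_i \sum_j \sum_p \sum_q
      \sum_(s : {perm T}) D i j p q * (D i j p q * stein' t (W s)).
    rewrite /K -b2 -(contrast_sum1 row0 col0) mulrC -contrast_sumZ.
    do 4![apply: eq_bigr => ? _].
    by rewrite mulr1 mulr_sumr; apply: eq_bigr => ? _; ring.
  under eq_bigr do rewrite -stein_eq.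
  rewrite sumrB mulrBr KE (zero_bias_identity row0 col0 (stein t)).
  do 4![rewrite -sumrB; apply: eq_bigr => ? _].
  by rewrite -sumrB; apply: eq_bigr => ? _; rewrite -mulrBr.
have -> : K * (#|T|)`!%:R * `|perm_cdf t - ncdf t| =
    `|K * \sum_(s : {perm T}) (((W s <= t)%R : nat)%:R - ncdf t)|.
  rewrite sumrB sum_cst card_all_perms normrM (gtr0_norm K0) -mulrA; congr (_ * _).
  rewrite -[X in X * _](gtr0_norm F0) -normrM mulrBr /perm_cdf; congr (`|_ - _|).
  by rewrite mulrC divfK // gt_eqF.
rewrite e.
do 4![rewrite (le_trans (ler_norm_sum _ _ _)) //; apply: ler_sum => ? _].
rewrite (le_trans (ler_norm_sum _ _ _)) //; apply: ler_sum => ? _.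
by rewrite normrM /gap /stein_gap subKr.
Qed.

Lemma measurable_perm_cdf : measurable_fun [set: R] perm_cdf.
Proof.
apply: measurable_funM => //; apply: measurable_sum => s.
have -> : (fun t => ((W s <= t)%R : nat)%:R : R) = \1_(`[W s, +oo[%classic).
  by apply/funext => t; rewrite indicE mem_setE in_itv /= andbT.
exact: measurable_indic.
Qed.

Lemma perm_cdf_L1 : (3 <= #|T|)%N -> \sum_i \sum_j b i j ^+ 2 = N - 1 ->
  (\int[mu]_t (`|perm_cdf t - ncdf t|)%:E <=
   ((\sum_i \sum_p `|b i p| ^+ 3) / (N - 1) *
    (16 + 56 / (N - 1) + 8 / (N - 1) ^+ 2))%:E)%E.
Proof.
move=> T3 b2; have T1 : (1 < #|T|)%N by exact: leq_trans T3.
have K0 := zero_bias_factor_gt0 T1.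
have F0 : 0 < (#|T|)`!%:R :> R by rewrite ltr0n fact_gt0.
set K := 4 * _ * (N - 1) in K0.
have md : measurable_fun [set: R] (fun t => `|perm_cdf t - ncdf t|).
  apply: measurableT_comp => //; apply: measurable_funB; first exact: measurable_perm_cdf.
  by apply: continuous_measurable_fun; exact: ncdf_continuous.
have KF0 : 0 < K * (#|T|)`!%:R by rewrite mulr_gt0.
have le : (\int[mu]_t (K * (#|T|)`!%:R * `|perm_cdf t - ncdf t|)%:E <=
    (\sum_i \sum_j \sum_p \sum_q \sum_(s : {perm T}) `|D i j p q| *
      (`|D i j p q| * (`|W (couple i j p q s) - W s| +
                       `|W (couple i j p q s) - D i j p q - W s|)))%:E)%E.
  rewrite !pair_bigA /=.
  apply: (@integral_le_sum R _ _ (fun x => `|D x.1.1.1.1 x.1.1.1.2 x.1.1.2 x.1.2|) _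
    (fun x => gap x.1.1.1.1 x.1.1.1.2 x.1.1.2 x.1.2 x.2)).
  - exact: measurable_funM.
  - by move=> x; exact: measurable_stein_gap.
  - by move=> t; rewrite mulr_ge0 // ltW.
  - by move=> x t; rewrite normr_ge0.
  - by move=> x; rewrite normr_ge0.
  - move=> t; have := discrepancy_le t T1 b2.
    by rewrite !pair_bigA.
  - move=> x; apply: le_trans (integral_stein_gap _ _ _) _.
    by rewrite subKr lee_fin [X in _ * X]addrC.
have leE : (\int[mu]_t (K * (#|T|)`!%:R * `|perm_cdf t - ncdf t|)%:E =
    (K * (#|T|)`!%:R)%:E * \int[mu]_t (`|perm_cdf t - ncdf t|)%:E)%E.
  under eq_integral do rewrite EFinM.
  rewrite ge0_integralZl_EFin //; last exact: ltW.
  by apply/measurable_EFinP; exact: md.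
rewrite -(@lee_pmul2l _ (K * (#|T|)`!%:R)%:E) ?lte_fin //.
rewrite -leE; apply: le_trans le _; rewrite -EFinM lee_fin.
have N1 : 1 < N by rewrite ltr1n.
apply: (@le_trans _ _ ((#|T|)`!%:R * contrast_sum b (dist_bound b))).
  rewrite -contrast_sumZ; apply: ler_sum => i _; apply: ler_sum => j _.
  apply: ler_sum => p _; apply: ler_sum => q _.
  under eq_bigr do rewrite mulrA -expr2 real_normK ?num_real //.
  rewrite -mulr_sumr.
  (* Degenerate indices, outside the scope of [sum_couple_dist], carry weight zero. *)
  have [<-|ij] := eqVneq i j; first by rewrite contrast_diag_l expr0n !mul0r.
  have [<-|pq] := eqVneq p q; first by rewrite contrast_diag_r expr0n !mul0r.
  by rewrite ler_wpM2l ?sqr_ge0 // sum_couple_dist.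
(* The factor [4 * N ^+ 2] cancels against [K] and leaves the division by [N - 1]. *)
apply: le_trans (ler_wpM2l (ltW F0) (contrast_sum_dist row0 col0 T3)) _.
rewrite le_eqVlt; apply/orP; left; apply/eqP; rewrite /K.
set S3 := \sum_i _; field; by rewrite subr_eq0 gt_eqF.
Qed.

End perm_sum_distance.

(** * Uniform random permutations *)

(** The integrand is a simple function on the level sets of [pi], which are equally likely. *)
Lemma integral_uniform_perm (R : realType) (n : nat) (d : measure_display)
    (T : measurableType d) (P : probability T R) (pi : {RV P >-> {perm 'I_n}})
    (g : {perm 'I_n} -> R) : uniform_perm pi ->
  (\int[P]_w (g (pi w))%:E = ((\sum_s g s) / n`!%:R)%:E)%E.
Proof.
move=> hpi.
have mE s : measurable (pi @^-1` [set s]) by exact: measurable_funPTI.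
have -> : (fun w => (g (pi w))%:E) =
    (fun w => \sum_s ((g s)%:E * (\1_(pi @^-1` [set s]) w)%:E))%E.
  apply/funext => w; rewrite (bigD1 (pi w)) //= big1 => [|s spi].
    by rewrite indicE mem_set // mule1 adde0.
  by rewrite indicE memNset ?mule0 // => /= e; rewrite e eqxx in spi.
rewrite integral_sum //; last first.
  by move=> s; apply: integrableZl => //; exact: integrable_indic.
rewrite mulr_suml -sumEFin; apply: eq_bigr => s _.
rewrite integralZl //; last exact: integrable_indic.
by rewrite integral_indic // setIT EFinM; congr (_ * _)%E; exact: hpi.
Qed.

(** * Reduction to a doubly centered array *)

Section centering.
Variables (R : realType) (n : nat) (A : 'M[R]_n).
Hypothesis n_gt0 : (0 < n)%N.

Definition centered i j := A i j - mean_row A i - mean_col A j + mean_all A.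

Let n0 : n%:R != 0 :> R. Proof. by rewrite pnatr_eq0 -lt0n. Qed.

Let sumc (c : R) : \sum_(i < n) c = n%:R * c.
Proof. by rewrite sum_cst card_ord. Qed.

Let sum_row i : \sum_j A i j = n%:R * mean_row A i.
Proof. by rewrite mulrC divfK. Qed.

Let sum_col j : \sum_i A i j = n%:R * mean_col A j.
Proof. by rewrite mulrC divfK. Qed.

Let sum_mean_row : \sum_i mean_row A i = n%:R * mean_all A.
Proof. by rewrite -mulr_suml /mean_all; field. Qed.

Let sum_mean_col : \sum_j mean_col A j = n%:R * mean_all A.
Proof. by rewrite -mulr_suml exchange_big /mean_all; field. Qed.

Lemma centered_row0 i : \sum_j centered i j = 0.
Proof. by rewrite !big_split /= !sumrN sum_row !sumc sum_mean_col; ring. Qed.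

Lemma centered_col0 j : \sum_i centered i j = 0.
Proof. by rewrite !big_split /= !sumrN sum_col !sumc sum_mean_row; ring. Qed.

Lemma perm_sum_centered s : perm_sum centered s = permY A s - mu A.
Proof.
rewrite /perm_sum !big_split /= !sumrN sumc sum_mean_row /permY /mu.
have -> : \sum_i mean_col A (s i) = n%:R * mean_all A.
  by rewrite -sum_mean_col [RHS](reindex_inj (@perm_inj _ s)).
ring.
Qed.

(** Insert [A i j = centered i j + r i + c j - m] in [sigma2] and expand: the cross terms [S1],
    [S2], [S3] vanish by centering. *)
Lemma sum_centered_sqr :
  (\sum_i \sum_j centered i j ^+ 2) / (n%:R - 1) = sigma2 A.
Proof.
congr (_ / _).
pose r := mean_row A; pose c := mean_col A; pose m := mean_all A.
have S1 : \sum_i \sum_j 2 * (r i - m) * centered i j = 0.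
  by rewrite big1 // => i _; rewrite -mulr_sumr centered_row0 mulr0.
have S2 : \sum_i \sum_j 2 * c j * centered i j = 0.
  by rewrite exchange_big big1 // => j _; rewrite -mulr_sumr centered_col0 mulr0.
have S3 : \sum_i \sum_j 2 * (r i - m) * (c j - m) = 0.
  rewrite big1 // => i _; rewrite -mulr_sumr sumrB sum_mean_col sumc.
  by rewrite subrr mulr0.
transitivity (\sum_i \sum_j centered i j ^+ 2 +
    \sum_i \sum_j 2 * (r i - m) * centered i j +
    \sum_i \sum_j 2 * c j * centered i j +
    \sum_i \sum_j 2 * (r i - m) * (c j - m)); first by rewrite S1 S2 S3 !addr0.
rewrite -!big_split; apply: eq_bigr => i _; rewrite -!big_split; apply: eq_bigr => j _ /=.
rewrite /centered -/(r i) -/(c j) -/m; ring.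
Qed.

End centering.

Section uniform_permutation.
Variables (R : realType) (n : nat) (A : 'M[R]_n).
Variables (d : measure_display) (T : measurableType d) (P : probability T R).
Variable pi : {RV P >-> {perm 'I_n}}.
Hypotheses (hn : (3 <= n)%N) (hpi : uniform_perm pi).

Let n_gt0 : (0 < n)%N. Proof. exact: leq_trans hn. Qed.
Let n_gt1 : (1 < n)%N. Proof. exact: leq_trans hn. Qed.
Let card_gt1 : (1 < #|'I_n|)%N. Proof. by rewrite card_ord. Qed.

Let permYE s : permY A s = perm_sum (centered A) s + mu A.
Proof. by rewrite perm_sum_centered // subrK. Qed.

Lemma expectation_permY : ('E_P[permY A \o pi] = (mu A)%:E)%E.
Proof.
rewrite unlock (integral_uniform_perm (permY A) hpi); congr EFin.
under eq_bigr do rewrite permYE.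
rewrite big_split /= sum_perm_sum //; [|exact: centered_row0|exact: centered_col0].
rewrite add0r sum_cst card_all_perms card_ord mulrAC divff ?mul1r //.
Qed.

Lemma variance_permY : ('V_P[permY A \o pi] = (sigma2 A)%:E)%E.
Proof.
rewrite /variance unlock expectation_permY unlock.
rewrite (integral_uniform_perm (fun s => (permY A s - mu A) * (permY A s - mu A)) hpi).
congr EFin; under eq_bigr do rewrite -perm_sum_centered // -expr2.
have := sum_perm_sum_sqr (centered_row0 A n_gt0) (centered_col0 A n_gt0) card_gt1.
by rewrite card_ord sum_centered_sqr.
Qed.

Lemma cdf_permW t : cdf (permW A \o pi : {RV P >-> R}) t =
  (perm_cdf (fun i j => centered A i j / sigma A) t)%:E.
Proof.
rewrite /cdf /distribution /= /pushforward.
have -> : P ((permW A \o pi) @^-1` `]-oo, t]) =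
    (\int[P]_w (((permW A (pi w) <= t)%R : nat)%:R : R)%:E)%E.
  rewrite -[_ @^-1` _]setIT -integral_indic //; last first.
    exact: (measurable_funPTI (permW A \o pi : {RV P >-> R})).
  apply: eq_integral => w _; rewrite indicE; congr ((nat_of_bool _)%:R%:E).
  by apply/idP/idP; rewrite inE /= in_itv.
rewrite (integral_uniform_perm (fun s => ((permW A s <= t)%R : nat)%:R) hpi).
rewrite /perm_cdf card_ord; congr (_ / _)%:E; apply: eq_bigr => s _.
by rewrite /perm_sum -mulr_suml -/(perm_sum _ s) perm_sum_centered.
Qed.

Lemma dist_L1_permW : 0 < sigma2 A ->
  (dist_L1 (cdf (permW A \o pi : {RV P >-> R})) (@Phi R) <=
    (a3 A / ((n%:R - 1) * sigma A ^+ 3) *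
     (16 + 56 / (n%:R - 1) + 8 / (n%:R - 1) ^+ 2))%:E)%E.
Proof.
move=> s2; have s0 : 0 < sigma A by rewrite sqrtr_gt0.
rewrite /dist_L1; under eq_integral do rewrite cdf_permW PhiE -EFinB abse_EFin.
pose b i j := centered A i j / sigma A.
have row0 i : \sum_j b i j = 0 by rewrite -mulr_suml centered_row0 ?mul0r.
have col0 j : \sum_i b i j = 0 by rewrite -mulr_suml centered_col0 ?mul0r.
have n1 : 1 < n%:R :> R by rewrite ltr1n.
(* Division by [sigma] gives the unit variance normalization that [perm_cdf_L1] asks for. *)
have b2 : \sum_i \sum_j b i j ^+ 2 = #|'I_n|%:R - 1.
  rewrite card_ord.
  transitivity ((\sum_i \sum_j centered A i j ^+ 2) / sigma A ^+ 2).
    rewrite mulr_suml; apply: eq_bigr => i _; rewrite mulr_suml.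
    by apply: eq_bigr => j _; rewrite /b exprMn exprVn.
  rewrite sqr_sqrtr ?ltW // -sum_centered_sqr // invf_div mulrC divfK //.
  by apply: contraTneq s2 => e; rewrite -sum_centered_sqr // e mul0r ltxx.
have := perm_cdf_L1 row0 col0 _ b2; rewrite card_ord => /(_ hn) /le_trans; apply.
rewrite lee_fin le_eqVlt; apply/orP; left; apply/eqP; congr (_ * _).
transitivity (a3 A / sigma A ^+ 3 / (n%:R - 1)).
  congr (_ / _); rewrite mulr_suml; apply: eq_bigr => i _; rewrite mulr_suml.
  by apply: eq_bigr => j _; rewrite /b normrM normfV (gtr0_norm s0) exprMn exprVn.
by rewrite -mulrA -invfM [_ ^+ 3 * _]mulrC.
Qed.

End uniform_permutation.

Theorem theorem6p1 (R : realType) (n : nat) (hn : (3 <= n)%N)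
    (A : 'M[R]_n) (d : measure_display) (T : measurableType d)
    (P : probability T R) (pi : {RV P >-> {perm 'I_n}})
    (hpi : uniform_perm pi) :
  let Y : {RV P >-> R} := permY A \o pi in
  let W : {RV P >-> R} := permW A \o pi in
  [/\ ('E_P[Y] = (mu A)%:E)%E,
      ('V_P[Y] = (sigma2 A)%:E)%E &
      0 < sigma2 A ->
      (dist_L1 (cdf W) (@Phi R) <=
        (a3 A / ((n%:R - 1) * sigma A ^+ 3) *
         (16 + 56 / (n%:R - 1) + 8 / (n%:R - 1) ^+ 2))%:E)%E ].
Proof.
split; [exact: expectation_permY|exact: variance_permY|exact: dist_L1_permW].
Qed.
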